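(* Let $H$ be a complex Hilbert space and let $\phi: S(H)\to S(H)$ be a bijective map (not assumed to be linear or affine in any sense) which preserves the Bures distance, that is, $d_b(\phi(A),\phi(B))=d_b(A,B)$ for all $A,B\in S(H)$. Then there is an either unitary or antiunitary operator $U$ on $H$ such that $$\phi(A)=UAU^*\qquad (A\in S(H)).$$
   Context: $H$ is a complex Hilbert space (of arbitrary dimension). $C_1(H)$ denotes the set of all trace-class operators on $H$, i.e. bounded linear operators whose absolute value has finite trace, and $\operatorname{tr}$ is the trace functional. $S(H)$ is the set of all positive (i.e. positive semidefinite) operators $A\in C_1(H)$ with $\operatorname{tr}A=1$ (the normal states). For $A,B\in S(H)$ the fidelity is $F(A,B)=\operatorname{tr}\big((A^{1/2}BA^{1/2})^{1/2}\big)$, and the Bures metric is $$d_b(A,B)=(\operatorname{tr}A+\operatorname{tr}B-2F(A,B))^{1/2}.$$ An antiunitary operator on $H$ is a conjugate-linear bijection $U:H\to H$ with $\langle Ux,Uy\rangle=\overline{\langle x,y\rangle}$ for all $x,y\in H$; its adjoint is $U^*=U^{-1}$ (as for unitary operators). *)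

(* Defs.v *)
From mathcomp Require Import all_boot all_order all_algebra.
From mathcomp Require Import complex.
From mathcomp Require Import all_classical all_reals all_analysis.
From mathcomp.analysis.showcase Require summability.

Set Implicit Arguments.
Unset Strict Implicit.
Unset Printing Implicit Defensive.

Import Order.TTheory GRing.Theory Num.Theory.
Import numFieldNormedType.Exports.

Local Open Scope classical_set_scope.
Local Open Scope ring_scope.
Local Open Scope complex_scope.

(* [{dot H for conj}] is a positive definite form, linear in the first
   argument and conjugate-linear in the second. *)
Record hilbertType (R : realType) := HilbertType {
  hilbert_sort :> completeNormedModType R[i];
  inner : {dot hilbert_sort for (@Num.conj R[i])};
  inner_norm : forall x : hilbert_sort, `|x| ^+ 2 = inner x x }.

Arguments inner {R h}.

Section Operators.
Context {R : realType} {H : hilbertType R}.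
Implicit Types (A B S T U : H -> H) (E : set H).

Definition bounded_op A : Prop :=
  GRing.linear_for *:%R A /\
  exists M : R, forall x : H, `|A x| <= M%:C * `|x|.

(* The order of [R[i]] makes this say that [inner (A x) x] is
   real and nonnegative. *)
Definition positive_op A : Prop :=
  bounded_op A /\ forall x : H, 0 <= inner (A x) x.

(* [get P] is an element of [P] if there is one. The element described below
   exists and is unique for every bounded [A] in the case of [adjoint], for
   every positive [A] in the case of [sqrt_op]. *)
Definition adjoint A : H -> H :=
  get [set B : H -> H |
    bounded_op B /\ forall x y : H, inner (A x) y = inner x (B y)].

Definition sqrt_op A : H -> H :=
  get [set S : H -> H | positive_op S /\ S \o S = A].

Definition abs_op A : H -> H := sqrt_op (adjoint A \o A).

Definition orthonormal_basis E : Prop :=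
  (forall e f : H, E e -> E f -> inner e f = (e == f)%:R) /\
  (forall x : H, (forall e, E e -> inner x e = 0) -> x = 0).

(* Traces are computed in one fixed basis; for positive and for trace-class
   operators the value does not depend on it. *)
Definition onb : set H := get [set E : set H | orthonormal_basis E].

Definition trace_class A : Prop :=
  bounded_op A /\
  (\esum_(e in onb) (complex.Re (inner (abs_op A e) e))%:E < +oo)%E.

(* The limit of the partial sums over the finite subsets of [onb],
   directed by inclusion. *)
Definition tr A : R[i] :=
  summability.sum (fun e : onb => inner (A (val e)) (val e) : R[i]^o).

Definition states : set (H -> H) :=
  [set A | [/\ trace_class A, positive_op A & tr A = 1]].

Definition fidelity A B : R[i] :=
  tr (sqrt_op (sqrt_op A \o B \o sqrt_op A)).

(* A nonnegative real number, seen in [R[i]] like the traces. *)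
Definition bures_dist A B : R[i] :=
  sqrtC (tr A + tr B - fidelity A B *+ 2).

Definition unitary_op U : Prop :=
  [/\ GRing.linear_for *:%R U, bijective U &
      forall x y : H, inner (U x) (U y) = inner x y].

Definition antiunitary_op U : Prop :=
  [/\ GRing.linear_for (Num.conj \; *:%R) U, bijective U &
      forall x y : H, inner (U x) (U y) = Num.conj (inner x y)].

(* The inverse map of a bijection; it is the adjoint [U^*] when [U] is unitary
   or antiunitary. *)
Definition inv_op U : H -> H := fun y => get [set x : H | U x = y].

End Operators.

Arguments onb {R} H.
Arguments states {R} H.

(* Main.v *)
Require Import Defs.
From mathcomp Require Import all_boot all_order all_algebra.
From mathcomp Require Import complex.
From mathcomp Require Import all_classical all_reals all_analysis.
From mathcomp Require Import finmap ring lra.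
From mathcomp.analysis.showcase Require summability.

(** The fidelity with a pure state is an expectation value. For a unit vector
    [x], the rank-one projection [rank1 x] is its own square root and
    [rank1 x \o A \o rank1 x] is the multiple [<A x, x>] of [rank1 x], so that
    [fidelity (rank1 x) A] is the square root of [<A x, x>]
    ([fidelity_rank1]). Hence a state is determined by its fidelities with the
    pure states, and it is enough to control the action of [phi] on pure states.

    Since states have trace one, the Bures distance determines the fidelity, so
    [phi] preserves fidelity. Fidelity detects pure states:
    - [fidelity C A = 0] exactly when [A] vanishes on the range of the square root
      of [C], that is, when the supports are orthogonal;
    - a state [A] is pure exactly when every state [B], such that all states
      orthogonal to [A] are also orthogonal to [B], equals [A] ([pure],
      [rank1_pure], [pure_rank1]): such a [B] is a state supported in the closed
      range of [A], and this range is a line only for a rank-one projection.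

    This condition mentions only fidelity and all states, so [phi] and its
    inverse preserve it ([pure_preserved]). On pure states the fidelity of
    [rank1 x] and [rank1 y] is [|<x, y>|], so [phi] induces a bijection of the
    lines of [H] that preserves the modulus of inner products. Wigner's theorem
    ([wigner]) gives [U] with [phi (rank1 x) = rank1 (U x)]. Finally
    [<phi A (U x), U x> = <A x, x>] for all [x], and polarization gives
    [phi A = U A U^-1] ([fidelity_preserver]).

    Two parts need work beyond this. The fidelity is the trace of the square root
    [M] of [T A T], where [T] is the square root of [C], and a vanishing trace
    forces [M = 0] only once the sum defining the trace of [M] is known to
    converge. With [S] the square root of [A], [M] is the absolute value of the
    product [S T] of two Hilbert-Schmidt operators, and [trace_sum_le1] bounds its
    trace. The polar decomposition is replaced by contractions [V k] built from
    geometric sums in [1 - M] that approximate its partial isometry. Square roots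
    themselves are obtained by the classical iteration [Y' = (T + Y ^ 2) / 2]
    ([root_fixpoint]). *)

Set Implicit Arguments.
Unset Strict Implicit.
Unset Printing Implicit Defensive.
Import Order.TTheory GRing.Theory Num.Theory.
Import numFieldNormedType.Exports.
Local Open Scope classical_set_scope.
Local Open Scope ring_scope.
Local Open Scope complex_scope.

(** * The real inner product and the norm *)

Section InnerProduct.
Context {R : realType} {H : hilbertType R}.
Implicit Types (x y z : H) (a b : R) (c : R[i]).

(** The form of [H] seen as a real Hilbert space. Inequalities are proved for it,
    because the order of [R] is total. *)
Definition rdot x y : R := complex.Re (inner x y).
Definition nrm x : R := complex.Re `|x|.
Definition sqmod c : R := complex.Re c ^+ 2 + complex.Im c ^+ 2.

Lemma sqmodE c : (sqmod c)%:C = c * c^*%C.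
Proof. by rewrite /sqmod add_Re2_Im2 sqr_normc. Qed.

Lemma sqmod_ge0 c : 0 <= sqmod c.
Proof. by rewrite addr_ge0 // sqr_ge0. Qed.

Lemma sqmod_eq0 c : sqmod c = 0 -> c = 0.
Proof.
move=> h; apply/eqP; rewrite -normr_eq0 -sqrf_eq0 -add_Re2_Im2.
by rewrite -/(sqmod c) h.
Qed.

Lemma sqmodM c d : sqmod (c * d) = sqmod c * sqmod d.
Proof. by case: c => ? ?; case: d => ? ?; rewrite /sqmod /=; ring. Qed.

Lemma sqmodJ c : sqmod c^* = sqmod c.
Proof. by case: c => ? ?; rewrite /sqmod /=; ring. Qed.

Lemma innerC x y : inner x y = (inner y x)^*.
Proof. by rewrite hermC expr0 mul1r. Qed.

Lemma innerDl x y z : inner (x + y) z = inner x z + inner y z.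
Proof. exact: linearDl. Qed.
Lemma innerDr x y z : inner z (x + y) = inner z x + inner z y.
Proof. exact: linearDr. Qed.
Lemma innerBl x y z : inner (x - y) z = inner x z - inner y z.
Proof. exact: linearBl. Qed.
Lemma innerBr x y z : inner z (x - y) = inner z x - inner z y.
Proof. exact: linearBr. Qed.
Lemma innerZl c x y : inner (c *: x) y = c * inner x y.
Proof. by rewrite linearZl_LR. Qed.
Lemma innerZr c x y : inner x (c *: y) = c^*%C * inner x y.
Proof. by rewrite linearZr_LR. Qed.
Lemma inner0l x : inner (0 : H) x = 0.
Proof. exact: linear0l. Qed.
Lemma inner0r x : inner x (0 : H) = 0.
Proof. exact: linear0r. Qed.

Lemma rdotC x y : rdot x y = rdot y x.
Proof. by rewrite /rdot innerC; case: (inner y x). Qed.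
Lemma rdotDl x y z : rdot (x + y) z = rdot x z + rdot y z.
Proof. by rewrite /rdot innerDl raddfD. Qed.
Lemma rdotDr x y z : rdot z (x + y) = rdot z x + rdot z y.
Proof. by rewrite /rdot innerDr raddfD. Qed.
Lemma rdotBl x y z : rdot (x - y) z = rdot x z - rdot y z.
Proof. by rewrite /rdot innerBl raddfB. Qed.
Lemma rdotBr x y z : rdot z (x - y) = rdot z x - rdot z y.
Proof. by rewrite /rdot innerBr raddfB. Qed.
Lemma rdotZl a x y : rdot (a%:C *: x) y = a * rdot x y.
Proof. by rewrite /rdot innerZl; case: (inner x y) => u v /=; ring. Qed.
Lemma rdotZr a x y : rdot x (a%:C *: y) = a * rdot x y.
Proof. by rewrite rdotC rdotZl rdotC. Qed.
Lemma rdot0l x : rdot (0 : H) x = 0.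
Proof. by rewrite /rdot inner0l. Qed.
Lemma rdot0r x : rdot x (0 : H) = 0.
Proof. by rewrite rdotC rdot0l. Qed.

(** The real form determines the complex one. *)
Lemma innerE x y : inner x y = rdot x y +i* rdot x ('i *: y).
Proof.
rewrite /rdot innerZr; case: (inner x y) => u v /=.
by congr (_ +i* _); ring.
Qed.

Lemma norm_nrm x : `|x| = (nrm x)%:C.
Proof. by rewrite RRe_real // normr_real. Qed.

Lemma inner_self x : inner x x = (nrm x ^+ 2)%:C.
Proof. by rewrite -inner_norm norm_nrm -rmorphXn. Qed.

Lemma rdot_self x : rdot x x = nrm x ^+ 2.
Proof. by rewrite /rdot inner_self. Qed.

Lemma nrm_ge0 x : 0 <= nrm x.
Proof. by rewrite -ler0c -norm_nrm. Qed.

Lemma nrm_eq0 x : nrm x = 0 -> x = 0.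
Proof. by move=> h; apply/eqP; rewrite -normr_eq0 norm_nrm h. Qed.

Lemma rdot_eq0 x : rdot x x = 0 -> x = 0.
Proof. by move/eqP; rewrite rdot_self sqrf_eq0 => /eqP /nrm_eq0. Qed.

Lemma rdot_ge0 x : 0 <= rdot x x.
Proof. by rewrite rdot_self sqr_ge0. Qed.

Lemma nrm0 : nrm 0 = 0.
Proof. by rewrite /nrm normr0. Qed.

Lemma nrmD x y : nrm (x + y) <= nrm x + nrm y.
Proof. by rewrite -lecR rmorphD /= -!norm_nrm ler_normD. Qed.

Lemma nrmN x : nrm (- x) = nrm x.
Proof. by rewrite /nrm normrN. Qed.

Lemma nrmB x y : nrm (x - y) <= nrm x + nrm y.
Proof. by rewrite -(nrmN y) nrmD. Qed.

Lemma nrmZ c x : nrm (c *: x) = complex.Re `|c| * nrm x.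
Proof.
rewrite /nrm normrZ norm_nrm -[ `|c| ]RRe_real ?normr_real //.
by rewrite -rmorphM.
Qed.

Lemma sqr_nrmZ c x : nrm (c *: x) ^+ 2 = sqmod c * nrm x ^+ 2.
Proof.
by rewrite nrmZ exprMn normc_def /= sqr_sqrtr // sqmod_ge0.
Qed.

Lemma nrmZr a x : 0 <= a -> nrm (a%:C *: x) = a * nrm x.
Proof.
move=> a0; apply/eqP; rewrite -(@eqrXn2 _ 2) ?nrm_ge0 ?mulr_ge0 ?nrm_ge0//.
by rewrite -!rdot_self rdotZl rdotZr rdot_self exprMn mulrA expr2.
Qed.

(** The squared norm of [<y, y> x - <x, y> y] is nonnegative. *)
Lemma cauchy_schwarz x y : sqmod (inner x y) <= rdot x x * rdot y y.
Proof.
have [->|y0] := eqVneq y 0.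
  by rewrite inner0r rdot0l /sqmod /= expr0n addr0 mulr0.
have yy : 0 < rdot y y.
  by rewrite lt_def rdot_ge0 andbT; apply: contra_neq y0; exact: rdot_eq0.
have := rdot_ge0 ((rdot y y)%:C *: x - inner x y *: y).
rewrite rdotBl !rdotBr !rdotZl !rdotZr.
have -> : rdot x (inner x y *: y) = sqmod (inner x y).
  by rewrite /rdot innerZr mulrC -sqmodE.
have -> : rdot (inner x y *: y) x = sqmod (inner x y).
  by rewrite rdotC /rdot innerZr mulrC -sqmodE.
have -> : rdot (inner x y *: y) (inner x y *: y) = sqmod (inner x y) * rdot y y.
  by rewrite !rdot_self sqr_nrmZ.
move=> h; have : 0 <= rdot y y * (rdot x x * rdot y y - sqmod (inner x y)).
  by move: h; congr (_ <= _); ring.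
by rewrite pmulr_rge0 // subr_ge0.
Qed.

Lemma rdot_le x y : `|rdot x y| <= nrm x * nrm y.
Proof.
rewrite -(@ler_pXn2r _ 2) ?nnegrE ?normr_ge0 ?mulr_ge0 ?nrm_ge0//.
rewrite real_normK ?num_real// exprMn -!rdot_self.
by apply: le_trans (cauchy_schwarz x y); rewrite lerDl sqr_ge0.
Qed.

Lemma rdot_orth_eq x y : (forall z, rdot x z = rdot y z) -> x = y.
Proof.
move=> h; apply/eqP; rewrite -subr_eq0; apply/eqP/rdot_eq0.
by rewrite rdotBl h subrr.
Qed.

Lemma inner_orth_eq x y : (forall z, inner x z = inner y z) -> x = y.
Proof. by move=> h; apply: rdot_orth_eq => z; rewrite /rdot h. Qed.

(** In the equality case the vector [<x, x> y - <y, x> x], whose squared norm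
    is the defect in the inequality up to a factor, vanishes. *)
Lemma cauchy_schwarz_eq x y :
  sqmod (inner x y) = rdot x x * rdot y y -> x != 0 -> exists c, y = c *: x.
Proof.
move=> h x0.
have xx : 0 < rdot x x.
  by rewrite lt_def rdot_ge0 andbT; apply: contra_neq x0; exact: rdot_eq0.
have xx' : (rdot x x)%:C != 0 by rewrite gt_eqF // ltcR.
(* the coefficient of the orthogonal projection of [y] on the line of [x] *)
exists ((rdot x x)%:C^-1 * inner y x).
suff : (rdot x x)%:C *: y = inner y x *: x.
  by move=> e; rewrite -scalerA -e scalerA mulVf // scale1r.
apply/eqP; rewrite -subr_eq0; apply/eqP/rdot_eq0.
rewrite rdotBl !rdotBr !rdotZl !rdotZr.
have -> : rdot y (inner y x *: x) = sqmod (inner y x).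
  by rewrite /rdot innerZr mulrC -sqmodE.
have -> : rdot (inner y x *: x) y = sqmod (inner y x).
  by rewrite rdotC /rdot innerZr mulrC -sqmodE.
have -> : rdot (inner y x *: x) (inner y x *: x) = sqmod (inner y x) * rdot x x.
  by rewrite !rdot_self sqr_nrmZ.
have -> : sqmod (inner y x) = rdot x x * rdot y y by rewrite innerC sqmodJ.
ring.
Qed.

End InnerProduct.

(** * Convergence of sequences of vectors *)

Section Convergence.
Context {R : realType} {H : hilbertType R}.
Implicit Types (x y z : H) (u v : nat -> H).

Definition hcvg u x : Prop := (fun n => nrm (u n - x)) @ \oo --> (0 : R).

Lemma hcvg_squeeze u x (b : nat -> R) :
  (forall n, nrm (u n - x) <= b n) -> b @ \oo --> (0 : R) -> hcvg u x.
Proof.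
move=> h bl; apply: (squeeze_cvgr _ (cvg_cst 0) bl).
by near=> n; rewrite nrm_ge0 h.
Unshelve. all: by end_near.
Qed.

Lemma hcauchy u : (forall eps : R, 0 < eps ->
    exists N, forall m n, (N <= m)%N -> (N <= n)%N -> nrm (u m - u n) < eps) ->
  exists x, hcvg u x.
Proof.
move=> h.
have : cvg (u @ \oo).
  apply/cauchy_cvgP/cauchy_ballP => e e0.
  have e0' : 0 < complex.Re e by move: e0; rewrite ltcE => /andP[].
  have [N hN] := h _ e0'.
  exists (u @` [set n | (N <= n)%N], u @` [set n | (N <= n)%N]).
    by split; exists N => // n /= hn; exists n.
  move=> [_ _] /= [[m hm <-] [n hn <-]]; rewrite -ball_normE /= norm_nrm.
  move: e0 => /gtr0_real /RRe_real <-.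
  by rewrite ltcR hN.
move=> /cvg_ex[x ux]; exists x.
apply/cvgrPdist_lt => e e0.
have e0' : 0 < e%:C by rewrite ltcR.
move/cvgrPdist_lt: ux => /(_ _ e0'); apply: filterS => n.
by rewrite norm_nrm ltcR sub0r normrN (ger0_norm (nrm_ge0 _)) -nrmN opprB.
Qed.

Lemma hcvg_cst x : hcvg (fun=> x) x.
Proof. by apply: (@hcvg_squeeze _ _ (fun=> 0)); [rewrite subrr nrm0|exact: cvg_cst]. Qed.

Lemma hcvgD u v x y : hcvg u x -> hcvg v y -> hcvg (fun n => u n + v n) (x + y).
Proof.
move=> ux vy; apply: (@hcvg_squeeze _ _ (fun n => nrm (u n - x) + nrm (v n - y))).
  by move=> n; rewrite opprD addrACA nrmD.
by rewrite -[X in _ --> X]addr0; exact: cvgD.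
Qed.

Lemma hcvg_bounded u x (A : H -> H) (M : R) :
  (forall y z, A (y - z) = A y - A z) -> (forall y, nrm (A y) <= M * nrm y) ->
  hcvg u x -> hcvg (fun n => A (u n)) (A x).
Proof.
move=> hA hM ux; apply: (@hcvg_squeeze _ _ (fun n => M * nrm (u n - x))).
  by move=> n; rewrite -hA.
by rewrite -[X in _ --> X](mulr0 M); exact: cvgMr.
Qed.

Lemma hcvgZ c u x : hcvg u x -> hcvg (fun n => c *: u n) (c *: x).
Proof.
apply: (@hcvg_bounded _ _ ( *:%R c) (complex.Re `|c|)).
  by move=> y z; rewrite scalerBr.
by move=> y; rewrite nrmZ.
Qed.

Lemma hcvg_rdot y u x : hcvg u x -> (fun n => rdot (u n) y) @ \oo --> rdot x y.
Proof.
move=> ux; apply/subr_cvg0.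
have h : (fun n => nrm (u n - x) * nrm y) @ \oo --> (0 : R).
  by rewrite -[X in _ --> X](mul0r (nrm y)); exact: cvgMl.
apply/norm_cvg0P.
apply: (squeeze_cvgr _ (cvg_cst 0) h); near=> n.
by rewrite normr_ge0 /= -rdotBl rdot_le.
Unshelve. all: by end_near.
Qed.

Lemma hcvg_uniq u x y : hcvg u x -> hcvg u y -> x = y.
Proof.
move=> ux uy; apply: rdot_orth_eq => z.
exact: (cvg_unique _ (hcvg_rdot ux) (hcvg_rdot uy)).
Qed.

Lemma hcvg_nrm u x : hcvg u x -> (fun n => nrm (u n)) @ \oo --> nrm x.
Proof.
move=> ux; apply/subr_cvg0/norm_cvg0P.
apply: (squeeze_cvgr _ (cvg_cst 0) ux); near=> n.
rewrite normr_ge0 /= ler_norml; apply/andP; split.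
  have := nrmB (u n) (u n - x); rewrite opprB addrC subrK; lra.
have := nrmD (u n - x) x; rewrite subrK; lra.
Unshelve. all: by end_near.
Qed.

End Convergence.

(** * Bounded, selfadjoint and positive operators *)

Lemma discriminant_le (R : realType) (a b c : R) : 0 <= c ->
  (forall t, 0 <= a + 2 * t * b + t ^+ 2 * c) -> b ^+ 2 <= a * c.
Proof.
rewrite le_eqVlt => /predU1P[<-|c0] h; last first.
  have := h (- b / c).
  have -> : a + 2 * (- b / c) * b + (- b / c) ^+ 2 * c = (a * c - b ^+ 2) / c.
    by field; rewrite gt_eqF.
  by rewrite pmulr_lge0 ?invr_gt0// subr_ge0.
rewrite mulr0; have [->|b0] := eqVneq b 0; first by rewrite expr0n.
(* for [c = 0] the affine function takes the value [-1] at this point *)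
have := h (- (a + 1) / (2 * b)); rewrite mulr0 addr0.
have -> : a + 2 * (- (a + 1) / (2 * b)) * b = - 1 by field.
by rewrite oppr_ge0 ler10.
Qed.

Section Operators.
Context {R : realType} {H : hilbertType R}.
Implicit Types (x y z : H) (A B S T Z : H -> H).

Definition lin A : Prop := GRing.linear_for *:%R A.
Definition commuting A B : Prop := forall x, A (B x) = B (A x).
Definition selfadjoint A : Prop := forall x y, inner (A x) y = inner x (A y).

Lemma linD A x y : lin A -> A (x + y) = A x + A y.
Proof. by move=> h; have := h 1 x y; rewrite !scale1r. Qed.
Lemma lin0 A : lin A -> A 0 = 0.
Proof.
by move=> h; apply: (addrI (A 0)); rewrite -linD// !addr0.
Qed.
Lemma linZ A c x : lin A -> A (c *: x) = c *: A x.
Proof. by move=> h; have := h c x 0; rewrite (lin0 h) !addr0. Qed.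
Lemma linN A x : lin A -> A (- x) = - A x.
Proof. by move=> h; rewrite -scaleN1r (linZ _ _ h) scaleN1r. Qed.
Lemma linB A x y : lin A -> A (x - y) = A x - A y.
Proof. by move=> h; rewrite (linD _ _ h) (linN _ h). Qed.

Lemma boundedP A : bounded_op A ->
  exists2 M : R, 0 < M & forall x, nrm (A x) <= M * nrm x.
Proof.
move=> [_ [M hM]]; exists (`|M| + 1); first by rewrite ltr_wpDl.
move=> x; have := hM x; rewrite !norm_nrm -rmorphM /= lecR => /le_trans -> //.
rewrite ler_wpM2r ?nrm_ge0//.
by apply: le_trans (ler_norm M) _; rewrite lerDl.
Qed.

Lemma bounded_opI A (M : R) : lin A -> (forall x, nrm (A x) <= M * nrm x) ->
  bounded_op A.
Proof.
move=> lA h; split=> //; exists M => x.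
by rewrite !norm_nrm -rmorphM /= lecR.
Qed.

Lemma bounded_comp A B : bounded_op A -> bounded_op B -> bounded_op (A \o B).
Proof.
move=> bA bB; have [M M0 hM] := boundedP bA; have [N N0 hN] := boundedP bB.
apply: (@bounded_opI _ (M * N)).
  by move=> c x y /=; rewrite bB.1 bA.1.
by move=> x /=; apply: le_trans (hM _) _; rewrite -mulrA ler_pM2l.
Qed.

Lemma hcvg_op A u x : bounded_op A -> hcvg u x -> hcvg (fun n => A (u n)) (A x).
Proof.
move=> bA; have [M M0 hM] := boundedP bA.
by apply: hcvg_bounded hM => y z; rewrite linB//; exact: bA.1.
Qed.

Lemma pos_inner A x : positive_op A -> inner (A x) x = (rdot (A x) x)%:C.
Proof. by move=> [_ /(_ x) /ger0_real /RRe_real]. Qed.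

Lemma pos_ge0 A x : positive_op A -> 0 <= rdot (A x) x.
Proof. by move=> pA; rewrite -ler0c -pos_inner //; case: pA. Qed.

(** Polarization: evaluating the diagonal at [x + y] and at [x + 'i y] gives both
    [f x y + f y x = 0] and [f x y - f y x = 0]. *)
Lemma sesquilinear_eq0 (f : H -> H -> R[i]) :
  (forall x y z, f (x + y) z = f x z + f y z) ->
  (forall x y z, f x (y + z) = f x y + f x z) ->
  (forall x y, f ('i *: x) y = 'i * f x y) ->
  (forall x y, f x ('i *: y) = - ('i * f x y)) ->
  (forall x, f x x = 0) -> forall x y, f x y = 0.
Proof.
move=> Dl Dr Zl Zr f0 x y.
have h1 : f x y + f y x = 0.
  by have := f0 (x + y); rewrite Dl !Dr !f0 add0r addr0.
have h2 : f x y - f y x = 0.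
  have := f0 (x + 'i *: y); rewrite Dl !Dr !Zl !Zr !f0 mulr0 oppr0 mulr0 addr0 add0r.
  rewrite addrC -mulrBr => /eqP; rewrite mulf_eq0 => /orP[/eqP[/eqP]|].
    by rewrite oner_eq0.
  by rewrite subr_eq0 eq_sym -subr_eq0 => /eqP.
have : 2%:R * f x y = 0.
  by rewrite mulr_natl mulr2n -[RHS]addr0 -{2}h1 -h2; ring.
by move=> /eqP; rewrite mulf_eq0 pnatr_eq0 /= => /eqP.
Qed.

Lemma inner_il x y : inner ('i *: x) y = 'i * inner x y.
Proof. exact: innerZl. Qed.
Lemma inner_ir x y : inner x ('i *: y) = - ('i * inner x y).
Proof.
rewrite innerZr -mulNr; congr (_ * _).
by apply/eqP; rewrite eq_complex /= oppr0 !eqxx.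
Qed.

(** Over the complex numbers, positivity already implies selfadjointness. *)
Lemma pos_sym A : positive_op A -> selfadjoint A.
Proof.
move=> pA x y; apply/eqP; rewrite -subr_eq0; apply/eqP.
have lA := pA.1.1.
move: x y; apply: sesquilinear_eq0 => [x y z|x y z|x y|x y|x].
- by rewrite linD// !innerDl; ring.
- by rewrite linD// !innerDr; ring.
- by rewrite linZ// !inner_il; ring.
- by rewrite linZ// !inner_ir; ring.
- by rewrite (innerC x) pos_inner// conjc_real subrr.
Qed.

Lemma selfadjoint_rdot A x y : selfadjoint A -> rdot (A x) y = rdot x (A y).
Proof. by rewrite /rdot => ->. Qed.

Lemma pos_rdot A x y : positive_op A -> rdot (A x) y = rdot x (A y).
Proof. by move=> /pos_sym h; exact: selfadjoint_rdot. Qed.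

Lemma positive_opI A : bounded_op A -> selfadjoint A ->
  (forall x, 0 <= rdot (A x) x) -> positive_op A.
Proof.
move=> bA sA pA; split=> // x.
rewrite lecE /= pA andbT.
have := innerC (A x) x; rewrite sA; case: (inner x (A x)) => u v /= [].
by move=> /eqP; rewrite -addr_eq0 -mulr2n mulrn_eq0 /= => /eqP ->.
Qed.

(** The Cauchy-Schwarz inequality for the semidefinite form of [A]. *)
Lemma pos_cauchy_schwarz A x y : positive_op A ->
  rdot (A x) y ^+ 2 <= rdot (A x) x * rdot (A y) y.
Proof.
move=> pA; apply: discriminant_le => [|t]; first exact: pos_ge0.
have := pos_ge0 (x + t%:C *: y) pA; have lA := pA.1.1.
rewrite linD// linZ// !rdotDl !rdotDr !rdotZl !rdotZr (pos_rdot y)//.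
rewrite (rdotC y); congr (_ <= _); ring.
Qed.

Lemma pos_ker A x : positive_op A -> rdot (A x) x = 0 -> A x = 0.
Proof.
move=> pA h; apply: rdot_eq0; apply/eqP; rewrite -sqrf_eq0 eq_le sqr_ge0 andbT.
by have := pos_cauchy_schwarz x (A x) pA; rewrite h mul0r.
Qed.

End Operators.

(** * Square roots of positive operators *)

Section SquareRootIteration.
Context {R : realType} {H : hilbertType R}.
Variable T : H -> H.
Hypotheses (linT : lin T) (symT : selfadjoint T).
Hypothesis contrT : forall x, nrm (T x) <= nrm x.

(** The iteration for a fixed point of [Y = (T + Y ^ 2) / 2]; if [Y] is such a
    fixed point then [1 - Y] is a square root of [1 - T]. *)
Fixpoint root_iter n : H -> H :=
  if n is m.+1 then fun x => (2^-1)%:C *: (T x + root_iter m (root_iter m x))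
  else fun=> 0.

(** The iteration of [root_iter] for the scalar [T = 1]; it dominates the norms and the
    increments of the operator iteration. *)
Fixpoint root_bound n : R :=
  if n is m.+1 then (1 + root_bound m ^+ 2) / 2 else 0.

Lemma root_iterS n x :
  root_iter n.+1 x = (2^-1)%:C *: (T x + root_iter n (root_iter n x)).
Proof. by []. Qed.

Lemma root_boundS n : root_bound n.+1 = (1 + root_bound n ^+ 2) / 2.
Proof. by []. Qed.

Lemma root_iter_lin n : lin (root_iter n).
Proof.
elim: n => [|n IH] c x y; first by rewrite /= scaler0 addr0.
rewrite !root_iterS !IH linT !scalerDr !scalerA [c * _]mulrC.
by rewrite addrACA.
Qed.

Lemma root_iter_sym n : selfadjoint (root_iter n).
Proof.
elim: n => [|n IH] x y; first by rewrite /= inner0l inner0r.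
by rewrite !root_iterS innerZl innerZr conjc_real innerDl innerDr !IH symT.
Qed.

Lemma root_iter_comm Z n : lin Z -> commuting Z T -> commuting Z (root_iter n).
Proof.
move=> lZ cZ; elim: n => [|n IH] x; first by rewrite /= (lin0 lZ).
by rewrite !root_iterS (linZ _ _ lZ) (linD _ _ lZ) cZ !IH.
Qed.

Lemma root_iter_commT n : commuting (root_iter n) T.
Proof. by move=> x; rewrite (root_iter_comm n linT). Qed.

Lemma root_iter_comm2 m n : commuting (root_iter m) (root_iter n).
Proof. apply: root_iter_comm; [exact: root_iter_lin|exact: root_iter_commT]. Qed.

Lemma root_bound_itv n : 0 <= root_bound n <= 1.
Proof. by elim: n => [|n /andP[h0 h1]] /=; rewrite ?lexx ?ler01//; nra. Qed.

Lemma root_iter_bound n x : nrm (root_iter n x) <= root_bound n * nrm x.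
Proof.
elim: n x => [|n IH] x; first by rewrite /= nrm0 mul0r.
rewrite root_iterS root_boundS nrmZr ?invr_ge0//.
have := nrmD (T x) (root_iter n (root_iter n x)).
have := contrT x; have := IH x; have := IH (root_iter n x).
have /andP[] := root_bound_itv n.
move: (nrm _) (nrm _) (nrm _) (nrm _) (nrm _) => a b c d e; nra.
Qed.

(** All iterates commute, so the difference of two consecutive squares factors as
    [(Y' - Y) (Y' + Y)]; the scalar sequence satisfies the same recursion with
    equality. *)
Lemma root_iter_step n x : nrm (root_iter n.+1 x - root_iter n x) <=
  (root_bound n.+1 - root_bound n) * nrm x.
Proof.
elim: n x => [|n IH] x.
  have := contrT x; rewrite root_iterS root_boundS /= subr0 addr0 nrmZr ?invr_ge0//; lra.
set Y := root_iter n; set Y' := root_iter n.+1.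
have -> : root_iter n.+2 x - root_iter n.+1 x =
    (2^-1)%:C *: (Y' (Y' x + Y x) - Y (Y' x + Y x)).
  rewrite [in LHS]root_iterS [in X in _ - X]root_iterS -/Y' -/Y -scalerBr.
  rewrite opprD addrACA subrr add0r; congr (_ *: _).
  have lY : lin Y by exact: root_iter_lin.
  have lY' : lin Y' by exact: root_iter_lin.
  rewrite (linD _ _ lY) (linD _ _ lY').
  by rewrite -[Y (Y' x)](root_iter_comm2 n.+1 n) addrKA.
have -> : root_bound n.+2 - root_bound n.+1 =
   2^-1 * (root_bound n.+1 - root_bound n) * (root_bound n.+1 + root_bound n).
  rewrite [in LHS]root_boundS [in X in _ - X]root_boundS.
  by set s := root_bound n.+1; set r := root_bound n; ring.
rewrite nrmZr ?invr_ge0// -!mulrA ler_pM2l ?invr_gt0//.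
apply: le_trans (IH _) _.
have h : 0 <= root_bound n.+1 - root_bound n.
  by have /andP[] := root_bound_itv n; rewrite root_boundS; nra.
rewrite ler_wpM2l//; apply: le_trans (nrmD _ _) _.
by rewrite mulrDl lerD// root_iter_bound.
Qed.

Lemma root_bound_mono m n : (m <= n)%N -> root_bound m <= root_bound n.
Proof.
move: m n; apply/nondecreasing_seqP => k.
by have /andP[] := root_bound_itv k; rewrite root_boundS; nra.
Qed.

Lemma root_iter_dist m n x : (m <= n)%N ->
  nrm (root_iter n x - root_iter m x) <= (root_bound n - root_bound m) * nrm x.
Proof.
elim: n => [|n IH]; first by rewrite leqn0 => /eqP ->; rewrite !subrr nrm0 mul0r.
rewrite leq_eqVlt => /predU1P[->|/IH h]; first by rewrite !subrr nrm0 mul0r.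
have -> : root_iter n.+1 x - root_iter m x =
  (root_iter n.+1 x - root_iter n x) + (root_iter n x - root_iter m x).
  by rewrite addrA subrK.
apply: le_trans (nrmD _ _) _; have := root_iter_step n x; move: h.
by move: (nrm x) (nrm _) (nrm _) => a b c; lra.
Qed.

Lemma root_bound_cvg : exists2 s : R, root_bound @ \oo --> s &
  forall n, root_bound n <= s.
Proof.
have c : cvgn root_bound.
  apply: nondecreasing_is_cvgn; first by move=> m n; exact: root_bound_mono.
  by exists 1 => _ [n _ <-]; case/andP: (root_bound_itv n).
exists (limn root_bound) => // n.
by apply: nondecreasing_cvgn_le => // a b; exact: root_bound_mono.
Qed.

(** The increments are dominated by those of a bounded increasing real sequence. *)
Lemma root_iter_cvg : exists Y : H -> H, forall x, hcvg (root_iter ^~ x) (Y x).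
Proof.
suff h x : exists y, hcvg (root_iter ^~ x) y by have [Y hY] := choice h; exists Y.
have [s sc sb] := root_bound_cvg.
apply: hcauchy => eps e0.
have e1 : 0 < eps / (1 + nrm x) by rewrite divr_gt0// ltr_wpDr// nrm_ge0.
have [N _ hN] : \forall n \near \oo, s - root_bound n < eps / (1 + nrm x).
  move/cvgrPdist_lt: sc => /(_ _ e1); apply: filterS => n.
  by rewrite ger0_norm// subr_ge0.
exists N => m n.
wlog mn : m n / (m <= n)%N => [hw|] hm hn.
  have [le|/ltnW le] := leqP m n; first exact: hw.
  by rewrite -nrmN opprB; exact: hw.
rewrite -nrmN opprB; apply: le_lt_trans (root_iter_dist x mn) _.
have := hN _ hm; rewrite ltr_pdivlMr ?ltr_wpDr ?nrm_ge0//= => h.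
apply: le_lt_trans h.
have := sb n; have := sb m; have := nrm_ge0 x.
by move: (nrm x) => t; nra.
Qed.

(** The last clause, inherited from the iterates, is what makes square roots
    unique. *)
Lemma root_fixpoint : exists Y : H -> H,
  [/\ bounded_op Y, selfadjoint Y, forall x, nrm (Y x) <= nrm x,
      forall x, Y x = (2^-1)%:C *: (T x + Y (Y x)) &
      forall Z, bounded_op Z -> commuting Z T -> commuting Z Y].
Proof.
have [Y hY] := root_iter_cvg; exists Y.
have linY : lin Y.
  move=> c x y; apply: (hcvg_uniq (hY _)).
  have := hcvgD (hcvgZ c (hY x)) (hY y).
  by under [X in hcvg X _ -> _]eq_fun => n do rewrite -root_iter_lin.
have contr x : nrm (Y x) <= nrm x.
  apply: (ler_cvg_to (hcvg_nrm (hY x)) (cvg_cst (nrm x))).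
  near=> n; apply: le_trans (root_iter_bound n x) _.
  by apply: ler_piMl; [exact: nrm_ge0|case/andP: (root_bound_itv n)].
have bY : bounded_op Y by apply: (bounded_opI (M := 1)) => // x; rewrite mul1r.
have symr x y : rdot (Y x) y = rdot x (Y y).
  have h1 := hcvg_rdot (y := y) (hY x); have h2 := hcvg_rdot (y := x) (hY y).
  rewrite (rdotC x).
  have e : (fun n => rdot (root_iter n x) y) = (fun n => rdot (root_iter n y) x).
    by apply/funext => n; rewrite (selfadjoint_rdot _ _ (root_iter_sym n)) rdotC.
  have {}h2 : (fun n => rdot (root_iter n x) y) @ \oo --> rdot (Y y) x by rewrite e.
  exact: (cvg_unique _ h1 h2).
split=> //.
- by move=> x y; rewrite !innerE -(linZ _ _ linY) !symr.
- move=> x; have h : hcvg (fun n => root_iter n.+1 x) (Y x).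
    have := hY x; rewrite /hcvg => h.
    by rewrite -(@cvg_shiftS _ (fun n => nrm (root_iter n x - Y x))) in h.
  apply: (hcvg_uniq h).
  under [X in hcvg X _]eq_fun => n do rewrite root_iterS.
  apply/hcvgZ/hcvgD; first exact: hcvg_cst.
  apply: (hcvg_squeeze (b := fun n => nrm (root_iter n x - Y x) +
      nrm (root_iter n (Y x) - Y (Y x)))).
    move=> n; have -> : root_iter n (root_iter n x) - Y (Y x) =
      root_iter n (root_iter n x - Y x) + (root_iter n (Y x) - Y (Y x)).
      by rewrite (linB _ _ (root_iter_lin n)) addrA subrK.
    apply: le_trans (nrmD _ _) _; rewrite lerD2r.
    apply: le_trans (root_iter_bound n _) _.
    by apply: ler_piMl; [exact: nrm_ge0|case/andP: (root_bound_itv n)].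
  by rewrite -[X in _ --> X]addr0; apply: cvgD; exact: hY.
- move=> Z bZ cZ x; have h := hcvg_op bZ (hY x).
  apply: (hcvg_uniq h); have := hY (Z x).
  by under [X in hcvg X _ -> _]eq_fun => n do rewrite -(root_iter_comm n bZ.1 cZ).
Unshelve. all: by end_near.
Qed.

End SquareRootIteration.

Section SquareRoot.
Context {R : realType} {H : hilbertType R}.
Implicit Types (x y z : H) (A B S Z : H -> H).

(** The Cauchy-Schwarz inequality for the form of [A], applied to [x] and [A x]. *)
Lemma pos_sqr_le A (M : R) x : positive_op A ->
  (forall y, nrm (A y) <= M * nrm y) -> nrm (A x) ^+ 2 <= M * rdot (A x) x.
Proof.
move=> pA hM; have [->|n0] := eqVneq (A x) 0.
  by rewrite nrm0 rdot0l mulr0 expr0n.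
have n1 : 0 < nrm (A x).
  by rewrite lt_def nrm_ge0 andbT; apply: contra_neq n0; exact: nrm_eq0.
have h1 := pos_cauchy_schwarz x (A x) pA.
have h2 := le_trans (ler_norm _) (rdot_le (A (A x)) (A x)).
have h3 := hM (A x); have h4 := pos_ge0 x pA.
move: h1; rewrite rdot_self.
have h5 : rdot (A (A x)) (A x) <= M * nrm (A x) ^+ 2.
  by apply: le_trans h2 _; rewrite expr2 mulrA ler_pM2r.
move=> h1; have := le_trans h1 (ler_wpM2l h4 h5).
have : 0 < nrm (A x) ^+ 2 by rewrite exprn_gt0.
move: (nrm (A x) ^+ 2) => q q0.
by rewrite expr2 mulrA ler_pM2r// mulrC.
Qed.

(** After division by a bound [M], [T = 1 - A / M] is a selfadjoint contraction, and
    [root_fixpoint] applies to it. *)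
Lemma sqrt_exists A : positive_op A -> exists S,
  [/\ positive_op S, S \o S = A &
      forall Z, bounded_op Z -> commuting Z A -> commuting Z S].
Proof.
move=> pA; have bA := pA.1; have lA := bA.1; have [M M0 hM] := boundedP bA.
have Mc : M%:C != 0 by rewrite gt_eqF // ltcR.
(* [T] is a contraction because [|A x|^2 <= M <A x, x>] *)
pose T x := x - (M^-1)%:C *: A x.
have linT : lin T.
  move=> c x y; rewrite /T lA scalerDr scalerBr !scalerA [_ * c]mulrC.
  by rewrite opprD addrACA.
have symT : selfadjoint T.
  move=> x y; rewrite /T innerBl innerBr innerZl innerZr conjc_real.
  by rewrite (pos_sym pA).
have contrT x : nrm (T x) <= nrm x.
  rewrite -(@ler_pXn2r _ 2) ?nnegrE ?nrm_ge0// -!rdot_self /T.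
  rewrite rdotBl !rdotBr !rdotZl !rdotZr [rdot x (A x)]rdotC rdot_self.
  have h := pos_sqr_le x pA hM; have h0 := pos_ge0 x pA.
  rewrite [rdot (A x) (A x)]rdot_self.
  have : M^-1 * (M^-1 * nrm (A x) ^+ 2) <= M^-1 * rdot (A x) x.
    by rewrite ler_pM2l ?invr_gt0// ler_pdivrMl.
  have : 0 <= M^-1 * rdot (A x) x by rewrite mulr_ge0// invr_ge0 ltW.
  by move: (M^-1 * (M^-1 * _)) (M^-1 * _) => a b; lra.
have [Y [bY symY contrY fixY commY]] := root_fixpoint linT symT contrT.
have lY := bY.1.
pose m : R[i] := (Num.sqrt M)%:C.
have mm : m * m = M%:C by rewrite -rmorphM /= -expr2 sqr_sqrtr // ltW.
(* [1 - Y] is a root of [A / M] *)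
pose S x := m *: (x - Y x); exists S.
have lS : lin S.
  move=> c x y; rewrite /S lY [in RHS]scalerA mulrC -scalerA -scalerDr.
  by congr (_ *: _); rewrite scalerBr opprD addrACA.
have bS : bounded_op S.
  apply: (@bounded_opI _ _ _ (Num.sqrt M * 2)) => // x.
  rewrite /S nrmZr ?sqrtr_ge0// -mulrA ler_wpM2l ?sqrtr_ge0//.
  by apply: le_trans (nrmB _ _) _; rewrite mulr_natl mulr2n lerD2l.
split.
- apply: positive_opI => //.
    move=> x y; rewrite /S innerZl innerZr conjc_real innerBl innerBr.
    by rewrite symY.
  move=> x; rewrite rdotZl mulr_ge0 ?sqrtr_ge0// rdotBl subr_ge0 rdot_self.
  apply: le_trans (ler_norm _) _; apply: le_trans (rdot_le _ _) _.
  by rewrite expr2 ler_wpM2r ?nrm_ge0.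
- apply/funext => x; rewrite /S /= (linZ _ _ lY) -scalerBr scalerA mm (linB _ _ lY).
  have h : T x = Y x + Y x - Y (Y x).
    have e : 2%:R * (2^-1)%:C = 1 :> R[i].
      by rewrite -(rmorph_nat (real_complex R)) -rmorphM /= divff ?pnatr_eq0.
    suff -> : Y x + Y x = T x + Y (Y x) by rewrite addrK.
    by rewrite -mulr2n -scaler_nat [in LHS]fixY scalerA e scale1r.
  have -> : x - Y x - (Y x - Y (Y x)) = x - T x by rewrite h -addrA -!opprD addrA.
  by rewrite /T opprB addrC subrK scalerA -rmorphM /= divff ?gt_eqF // scale1r.
- move=> Z bZ cZ x; have lZ := bZ.1; rewrite /S (linZ _ _ lZ) (linB _ _ lZ) commY//.
  by move=> y; rewrite /T (linB _ _ lZ) (linZ _ _ lZ) cZ.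
Qed.

(** Compare [S] with the root [Q] of [sqrt_exists]. They commute, so for
    [y = S x - Q x] one gets [S y + Q y = 0]; by positivity [S y = Q y = 0], and then
    [<y, y> = 0]. *)
Lemma sqrt_unique A S S' : positive_op S -> positive_op S' ->
  S \o S = A -> S' \o S' = A -> S = S'.
Proof.
move=> pS pS' hS hS'.
have [Q [pQ hQ cQ]] : exists Q, [/\ positive_op Q, Q \o Q = A &
   forall Z, bounded_op Z -> commuting Z A -> commuting Z Q].
  apply: sqrt_exists; rewrite -hS; split; first exact: bounded_comp pS.1 pS.1.
  by move=> x /=; rewrite (pos_sym pS) inner_self lecR sqr_ge0.
suff uniq B : positive_op B -> B \o B = A -> B = Q by rewrite (uniq S)// (uniq S').
move=> pB hB {S S' pS pS' hS hS'}.
have hB' x : B (B x) = A x by rewrite -hB.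
have hQ' x : Q (Q x) = A x by rewrite -hQ.
have cBQ : commuting B Q by apply: cQ pB.1 _ => x; rewrite -!hB'.
have lB := pB.1.1; have lQ := pQ.1.1.
apply/funext => x; apply/eqP; rewrite -subr_eq0; apply/eqP.
pose y := B x - Q x.
have sum0 : B y + Q y = 0.
  by rewrite /y (linB _ _ lB) (linB _ _ lQ) hB' hQ' cBQ addrA subrK subrr.
have e : rdot (B y) y + rdot (Q y) y = 0 by rewrite -rdotDl sum0 rdot0l.
have pBy := pos_ge0 y pB; have pQy := pos_ge0 y pQ.
have By0 : B y = 0 by apply: (pos_ker pB); lra.
have Qy0 : Q y = 0 by apply: (pos_ker pQ); lra.
apply: rdot_eq0; rewrite -/y {2}/y rdotBr -(pos_rdot _ _ pB) -(pos_rdot _ _ pQ).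
by rewrite By0 Qy0 rdot0l subrr.
Qed.

Lemma sqrt_opP A : positive_op A ->
  positive_op (sqrt_op A) /\ forall x, sqrt_op A (sqrt_op A x) = A x.
Proof.
move=> pA; have [S [pS hS _]] := sqrt_exists pA.
have [p h] := getI (P := [set S | positive_op S /\ S \o S = A]) (conj pS hS).
by split=> // x; rewrite -[in RHS]h.
Qed.

Lemma sqrt_opE A S : positive_op S -> (forall x, S (S x) = A x) -> sqrt_op A = S.
Proof.
move=> pS /funext hS.
have [p h] := getI (P := [set S | positive_op S /\ S \o S = A]) (conj pS hS).
exact: sqrt_unique h hS.
Qed.

End SquareRoot.

(** * Orthonormal bases and Parseval's identity *)

Section OrthonormalBasis.
Context {R : realType} {H : hilbertType R}.
Implicit Types (x y z e f : H) (s t : seq H).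

Definition orthonormal_set (E : set H) : Prop :=
  forall e f : H, E e -> E f -> inner e f = (e == f)%:R.

Lemma normalize x : x != 0 ->
  let u := ((nrm x)^-1)%:C *: x in inner u u = 1 /\ x = (nrm x)%:C *: u.
Proof.
move=> x0 u; have n0 : nrm x != 0 by apply: contra_neq x0; exact: nrm_eq0.
split; last by rewrite scalerA -rmorphM /= divff// scale1r.
by rewrite inner_self nrmZr ?invr_ge0 ?nrm_ge0// mulVf// expr1n.
Qed.

Lemma nrm_normalized x : x != 0 -> nrm (((nrm x)^-1)%:C *: x) = 1.
Proof.
move=> x0; rewrite nrmZr ?invr_ge0 ?nrm_ge0// mulVf//.
by apply: contra_neq x0; exact: nrm_eq0.
Qed.

(** A maximal orthonormal set, from Zorn's lemma. *)
Lemma onb_exists : exists E : set H, orthonormal_basis E.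
Proof.
have [E [oE mE]] : exists E, orthonormal_set E /\
    forall F, E `<` F -> ~ orthonormal_set F.
  apply: Zorn_bigcup => F FP tF e f [X FX Xe] [Y FY Yf].
  have [XY|YX] := tF _ _ FX FY; first by apply: (FP _ FY) => //; exact: XY.
  by apply: (FP _ FX) => //; exact: YX.
exists E; split=> // x xE; apply: contrapT => /eqP x0.
have [uu xu] := normalize x0; set u := _ *: x in uu xu.
have uE e : E e -> inner u e = 0 by move=> Ee; rewrite innerZl xE// mulr0.
have Eu e : E e -> inner e u = 0 by move=> Ee; rewrite innerC uE// rmorph0.
have nEu : ~ E u by move=> /uE; rewrite uu => /eqP; rewrite oner_eq0.
apply: (mE (u |` E)).
  split=> [|h]; first by move=> e Ee; right.
  by apply: nEu; apply: h; left.
move=> e f [->|Ee] [->|Ef]; rewrite ?eqxx//; last exact: oE.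
- rewrite uE//; case: eqP => // uf; by rewrite uf in nEu.
- rewrite Eu//; case: eqP => // uf; by rewrite -uf in nEu.
Qed.

Lemma onbP : orthonormal_basis (onb H).
Proof. by have [E bE] := onb_exists; exact: getI bE. Qed.

(** Finite subsets of the basis, as duplicate-free sequences. *)
Definition onseq s : Prop := uniq s /\ forall e, e \in s -> onb H e.

Definition proj s x : H := \sum_(e <- s) inner x e *: e.
Definition fourier_sum s x : R := \sum_(e <- s) sqmod (inner x e).

Lemma onseq_cons e s : onseq (e :: s) -> [/\ e \notin s, onb H e & onseq s].
Proof.
move=> [/= /andP[es us] h]; split=> //; first by apply: h; rewrite mem_head.
by split=> // f fs; apply: h; rewrite inE fs orbT.
Qed.

Lemma onseqU s t : onseq s -> onseq t -> onseq (undup (s ++ t)).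
Proof.
move=> [us hs_sum] [ut ht]; split; first exact: undup_uniq.
by move=> e; rewrite mem_undup mem_cat => /orP[/hs_sum|/ht].
Qed.

Lemma onseq_sum_le (F : H -> R) s t : onseq s -> (forall e, 0 <= F e) ->
  {subset s <= t} -> \sum_(e <- s) F e <= \sum_(e <- undup t) F e.
Proof.
move=> [us _] F0 st.
have h : perm_eq (undup t) (s ++ [seq e <- undup t | e \notin s]).
  apply: uniq_perm; first exact: undup_uniq.
    rewrite cat_uniq us filter_uniq ?undup_uniq// andbT.
    by apply/hasPn => e; rewrite mem_filter => /andP[].
  move=> e; rewrite mem_cat mem_filter mem_undup.
  by case es : (e \in s) => //=; exact: st.
by rewrite (perm_big _ h) big_cat /= lerDl sumr_ge0.
Qed.

Lemma inner_proj s x f : onseq s -> onb H f ->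
  inner (proj s x) f = if f \in s then inner x f else 0.
Proof.
rewrite /proj => + bf; elim: s => [|e s IH]; first by rewrite big_nil inner0l.
move=> /onseq_cons[es be os]; rewrite big_cons innerDl innerZl IH// in_cons.
rewrite (onbP.1 _ _ be bf) [f == e]eq_sym; have [<-|] := eqVneq e f.
  by rewrite (negbTE es) mulr1 addr0.
by rewrite mulr0 add0r.
Qed.

Lemma inner_projr s x y : inner y (proj s x) = \sum_(e <- s) (inner x e)^*%C * inner y e.
Proof.
rewrite /proj; elim: s => [|e s IH]; first by rewrite !big_nil inner0r.
by rewrite !big_cons innerDr innerZr IH.
Qed.

Lemma rdot_projr s x y : (forall e, e \in s -> inner y e = inner x e) ->
  rdot y (proj s x) = fourier_sum s x.
Proof.
move=> h; rewrite /rdot inner_projr /fourier_sum raddf_sum big_seq [RHS]big_seq.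
by apply: eq_bigr => e es; rewrite h// mulrC -sqmodE.
Qed.

Lemma rdot_proj s x : onseq s -> rdot (proj s x) (proj s x) = fourier_sum s x.
Proof.
move=> os; apply: rdot_projr => e es; rewrite inner_proj ?es//.
exact: os.2.
Qed.

(** Pythagoras; Bessel's inequality follows at once. *)
Lemma sqr_residual s x : onseq s ->
  rdot (x - proj s x) (x - proj s x) = rdot x x - fourier_sum s x.
Proof.
move=> os; rewrite rdotBl !rdotBr rdot_proj// [rdot (proj s x) x]rdotC.
by rewrite rdot_projr// subrr subr0.
Qed.

Lemma bessel s x : onseq s -> fourier_sum s x <= rdot x x.
Proof. by move=> os; rewrite -subr_ge0 -sqr_residual// rdot_ge0. Qed.

Lemma nrm_proj_sub s t x : onseq s -> onseq t -> {subset s <= t} ->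
  nrm (proj t x - proj s x) ^+ 2 = fourier_sum t x - fourier_sum s x.
Proof.
move=> os ot st.
have h e : e \in s -> inner (proj t x) e = inner x e.
  by move=> es; rewrite inner_proj ?st//; exact: os.2.
have -> : proj s x = proj s (proj t x).
  by rewrite /proj big_seq [RHS]big_seq; apply: eq_bigr => e /h ->.
rewrite -rdot_self sqr_residual// rdot_proj//; congr (_ - _).
by rewrite /fourier_sum big_seq [RHS]big_seq; apply: eq_bigr => e /h ->.
Qed.

(** Parseval's identity in the form used for traces. Along finite sets whose sums
    approach the supremum, the projections of [x] form a Cauchy sequence; the
    difference of [x] and its limit is orthogonal to the basis, hence zero. *)
Lemma parseval_approx x (eps : R) : 0 < eps ->
  exists2 s, onseq s & rdot x x - eps < fourier_sum s x.
Proof.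
pose D := [set fourier_sum s x | s in [set s | onseq s]].
have on0 : onseq [::] by split.
have supD : has_sup D.
  split; first by exists (fourier_sum [::] x); exists [::].
  by exists (rdot x x) => _ [s os <-]; exact: bessel.
pose sg := sup D.
have le_sg s : onseq s -> fourier_sum s x <= sg.
  by move=> os; apply: ub_le_sup; [exact: supD.2|exists s].
have /choice[S hS] : forall n, exists s, onseq s /\ sg - harmonic n < fourier_sum s x.
  move=> n; have h0 : 0 < harmonic n :> R by rewrite invr_gt0.
  by have [_ [s os <-] hs_sum] := sup_adherent h0 supD; exists s.
have dist n t : onseq t -> {subset S n <= t} ->
    nrm (proj t x - proj (S n) x) ^+ 2 < harmonic n.
  move=> ot st; have [os hs_sum] := hS n; rewrite nrm_proj_sub//.
  have := le_sg _ ot; lra.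
have small (d : R) : 0 < d -> exists N, forall n, (N <= n)%N -> harmonic n < d.
  move=> d0; have [N _ hN] : \forall n \near \oo, harmonic n < d :> R.
    move/cvgrPdist_lt: (@cvg_harmonic R) => /(_ _ d0); apply: filterS => n.
    by rewrite sub0r normrN ger0_norm /harmonic ?invr_ge0.
  by exists N.
have [p hp] : exists p, hcvg (fun n => proj (S n) x) p.
  apply: hcauchy => d d0; have d2 : 0 < (d / 2) ^+ 2 by rewrite exprn_gt0// divr_gt0.
  have [N hN] := small _ d2; exists N => m n hm hn.
  have ou := onseqU (hS m).1 (hS n).1; set u := undup _ in ou.
  have -> : proj (S m) x - proj (S n) x =
      (proj u x - proj (S n) x) - (proj u x - proj (S m) x).
    by rewrite opprB [RHS]addrC addrA subrK.
  apply: le_lt_trans (nrmB _ _) _; rewrite [d]splitr.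
  have half k : (N <= k)%N -> {subset S k <= u} ->
      nrm (proj u x - proj (S k) x) < d / 2.
    move=> hk su; rewrite -(@ltr_pXn2r _ 2) ?nnegrE ?nrm_ge0 ?divr_ge0 ?ltW//.
    by apply: lt_trans (hN _ hk); exact: dist.
  by apply: ltrD; apply: half => // e es; rewrite mem_undup mem_cat es ?orbT.
have res n f : onb H f -> sqmod (inner (x - proj (S n) x) f) <= harmonic n.
  move=> bf; have [os hs_sum] := hS n.
  rewrite innerBl inner_proj//; case: ifPn => fs.
    by rewrite subrr /sqmod /= expr0n addr0 invr_ge0.
  have of_ : onseq (f :: S n).
    split; first by rewrite /= fs os.1.
    by move=> e; rewrite inE => /predU1P[->//|]; exact: os.2.
  by have := le_sg _ of_; rewrite subr0 /fourier_sum big_cons -/(fourier_sum _ _); lra.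
have orth f z : onb H f -> (forall y, rdot y z ^+ 2 <= sqmod (inner y f)) ->
    rdot (x - p) z = 0.
  move=> bf hz; apply/eqP; rewrite rdotBl subr_eq0; apply/eqP.
  have h1 := hcvg_rdot (y := z) hp.
  suff h2 : (fun n => rdot (proj (S n) x) z) @ \oo --> rdot x z.
    exact: (cvg_unique _ h2 h1).
  apply/cvgrPdist_lt => d d0; have d2 : 0 < d ^+ 2 by rewrite exprn_gt0.
  have [N hN] := small _ d2; exists N => // n /= hn.
  rewrite -rdotBl -(@ltr_pXn2r _ 2) ?nnegrE ?normr_ge0 ?(ltW d0)//.
  rewrite real_normK ?num_real//; apply: le_lt_trans (hN _ hn).
  by apply: le_trans (hz _) _; exact: res.
have px : x = p.
  apply/eqP; rewrite -subr_eq0; apply/eqP/onbP.2 => f bf.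
  rewrite innerE !(orth f)// => y; rewrite /sqmod ?lerDl ?sqr_ge0//.
  by rewrite innerE /= lerDr sqr_ge0.
move=> eps0; suff : rdot x x <= sg.
  move=> h; have [_ [s os <-] hs_sum] := sup_adherent eps0 supD.
  by exists s => //; rewrite -/sg in hs_sum; lra.
have h := hcvg_nrm hp.
rewrite px rdot_self expr2.
apply: (ler_cvg_to (cvgM h h) (cvg_cst sg)).
near=> n; rewrite /= -expr2 -rdot_self rdot_proj ?le_sg//; exact: (hS n).1.
Unshelve. all: by end_near.
Qed.

End OrthonormalBasis.

(** * Traces, states and rank-one projections *)

Section Traces.
Context {R : realType} {H : hilbertType R}.
Implicit Types (x y z e f : H) (s t : seq H) (A : H -> H) (J : {fset onb H}).

Definition trace_sum A s : R := \sum_(e <- s) rdot (A e) e.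

(** [l] is the supremum of the finite diagonal sums. It is stated with
    approximations because both halves are used separately. *)
Definition is_trace A (l : R) : Prop :=
  (forall s, onseq s -> trace_sum A s <= l) /\
  forall eps, 0 < eps -> exists2 s, onseq s & l - eps < trace_sum A s.

Definition fset_vals J : seq H := [seq val u | u : onb H <- J].

Lemma onseq_fset_vals J : onseq (fset_vals J).
Proof.
split; first by rewrite map_inj_uniq ?fset_uniq//; exact: val_inj.
by move=> _ /mapP[e _ ->]; exact: set_mem (valP e).
Qed.

(** Traces are limits over finite subsets of the subtype of basis vectors, while
    the estimates are made over sequences in [H]. *)
Lemma onseq_fset s : onseq s -> exists J, s =i fset_vals J.
Proof.
move=> [us hs_sum]; exists [fset u | u in (pmap insub s : seq (onb H))]%fset => e.
apply/idP/mapP => [es|[u]].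
  have eb : e \in onb H by apply: mem_set; exact: hs_sum.
  exists (Sub e eb); last by rewrite SubK.
  by rewrite !inE /= mem_pmap_sub SubK.
by rewrite !inE /= mem_pmap_sub => ? ->.
Qed.

Lemma partial_sumE A J : positive_op A ->
  summability.partial_sum (fun e : onb H => inner (A (val e)) (val e)) J =
  (trace_sum A (fset_vals J))%:C.
Proof.
move=> pA; rewrite /summability.partial_sum -(big_seq_fsetE _ J xpredT
  (fun u : onb H => inner (A (val u)) (val u))).
rewrite /trace_sum big_map rmorph_sum /=.
by apply: eq_bigr => e _; rewrite pos_inner.
Qed.

(** The finite sums increase, so their limit is their supremum. *)
Lemma tr_eq A (l : R) : positive_op A -> is_trace A l -> tr A = l%:C.
Proof.
move=> pA [ub app]; rewrite /tr /summability.sum.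
have pF := @summability.totally_filter (onb H).
apply: (@norm_cvg_lim _ (R[i]^o)).
apply/cvgrPdist_lt => e e0.
have e0' : 0 < complex.Re e by move: e0; rewrite ltcE => /andP[].
have [s os hs_sum] := app _ e0'; have [J hJ] := onseq_fset os.
exists J => // K /= JK.
rewrite (partial_sumE _ pA) -rmorphB /= normc_def /= expr0n addr0 sqrtr_sqr.
have -> : e = (complex.Re e)%:C by rewrite RRe_real// gtr0_real.
have oK := onseq_fset_vals K.
have hK := ub _ oK; rewrite ltcR ger0_norm ?subr_ge0//.
have : trace_sum A s <= trace_sum A (undup (fset_vals K)).
  apply: onseq_sum_le => // [f|f]; first exact: pos_ge0.
  rewrite hJ => /mapP[u uJ ->]; apply: map_f.
  by move/fsubsetP: JK; exact.
by rewrite (undup_id oK.1); lra.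
Qed.

Lemma is_trace_exists A (M : R) : (forall s, onseq s -> trace_sum A s <= M) ->
  exists l, is_trace A l.
Proof.
move=> h; pose D := [set trace_sum A s | s in [set s | onseq s]].
have supD : has_sup D.
  split; first by exists (trace_sum A [::]); exists [::].
  by exists M => _ [s os <-]; exact: h.
exists (sup D); split=> [s os|eps e0].
  by apply: ub_le_sup; [exact: supD.2|exists s].
by have [_ [s os <-] hs_sum] := sup_adherent e0 supD; exists s.
Qed.

Lemma pos_adjoint A : positive_op A -> adjoint A = A.
Proof.
move=> pA; have [_ h] := getI (P := [set B : H -> H | bounded_op B /\
  forall x y : H, inner (A x) y = inner x (B y)]) (conj pA.1 (pos_sym pA)).
apply/funext => y; apply: inner_orth_eq => x.
by rewrite (innerC _ x) [RHS](innerC _ x) -h (pos_sym pA).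
Qed.

Lemma pos_abs A : positive_op A -> abs_op A = A.
Proof. by move=> pA; rewrite /abs_op pos_adjoint//; exact: sqrt_opE. Qed.

Lemma trace_sum_le_esum A s : onseq s ->
  ((trace_sum A s)%:E <= \esum_(e in onb H) (complex.Re (inner (A e) e))%:E)%E.
Proof.
move=> [us hs_sum]; apply: esum_ge; exists [set` s].
  by split; [exact: finite_seq|move=> e; exact: hs_sum].
by rewrite -fsbig_seq// sumEFin.
Qed.

Lemma esum_le_bound A (M : R) : (forall s, onseq s -> trace_sum A s <= M) ->
  (\esum_(e in onb H) (complex.Re (inner (A e) e))%:E <= M%:E)%E.
Proof.
move=> h; apply: ge_ereal_sup => _ /= [X [finX XI] <-].
rewrite fsbig_finite// sumEFin lee_fin; apply: h; split.
  exact: fset_uniq.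
by move=> e; rewrite in_fset_set// => /set_mem /XI.
Qed.

(** The finiteness built into [trace_class] is used here: it makes the sums bounded,
    and only then is the value [1] of the limit known to be their supremum. *)
Lemma state_trace_sum_le1 A s : states H A -> onseq s -> trace_sum A s <= 1.
Proof.
move=> [[bA fA] pA tA] os; rewrite pos_abs// in fA.
set E := esum _ _ in fA.
have [l hl] : exists l, is_trace A l.
  apply: (@is_trace_exists _ (fine E)) => t ot.
  have h := trace_sum_le_esum A ot; rewrite -lee_fin fineK// ge0_fin_numE//.
  by apply: le_trans h; rewrite lee_fin sumr_ge0// => e _; exact: pos_ge0.
have := tr_eq pA hl; rewrite tA => /complexI ->; exact: hl.1.
Qed.

Lemma statesI A : positive_op A -> is_trace A 1 -> states H A.
Proof.
move=> pA hA; split=> //; last by rewrite (tr_eq pA hA).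
split; first exact: pA.1.
by rewrite pos_abs//; apply: le_lt_trans (esum_le_bound hA.1) (ltry _).
Qed.

Definition rank1 x : H -> H := fun y => inner y x *: x.

Lemma lin_rank1 x : lin (rank1 x).
Proof.
by move=> c y z; rewrite /rank1 innerDl innerZl scalerDl scalerA.
Qed.

Lemma inner_rank1 x y z : inner (rank1 x y) z = inner y x * inner x z.
Proof. exact: innerZl. Qed.

Lemma positive_rank1 (c : R) x : 0 <= c -> positive_op (fun y => c%:C *: rank1 x y).
Proof.
move=> c0; apply: positive_opI.
- apply: (@bounded_opI _ _ _ (c * (nrm x * nrm x))) => [d y z|y].
    by rewrite lin_rank1 scalerDr !scalerA [_ * d]mulrC.
  rewrite nrmZr// -mulrA ler_wpM2l// nrmZ.
  have h : complex.Re `|inner y x| <= nrm y * nrm x.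
    rewrite normc_def /= -(@ler_pXn2r _ 2) ?nnegrE ?sqrtr_ge0 ?mulr_ge0 ?nrm_ge0//.
    by rewrite sqr_sqrtr ?sqmod_ge0// exprMn -!rdot_self cauchy_schwarz.
  apply: le_trans (ler_wpM2r (nrm_ge0 x) h) _.
  by have -> : nrm y * nrm x * nrm x = nrm x * nrm x * nrm y by ring.
- move=> y z; rewrite innerZl innerZr conjc_real; congr (_ * _).
  rewrite (innerC y (rank1 x z)) !inner_rank1 rmorphM /= mulrC.
  by congr (_ * _); exact: innerC.
- move=> y; rewrite rdotZl mulr_ge0// /rdot inner_rank1 (innerC x) -sqmodE /= -sqmodJ -innerC.
  exact: sqmod_ge0.
Qed.

Lemma trace_sum_rank1 (c : R) x s :
  trace_sum (fun y => c%:C *: rank1 x y) s = c * fourier_sum s x.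
Proof.
rewrite /trace_sum /fourier_sum mulr_sumr; apply: eq_bigr => e _.
by rewrite rdotZl /rdot inner_rank1 (innerC x) -sqmodE /= -sqmodJ -innerC.
Qed.

Lemma is_trace_rank1 (c : R) x : 0 <= c -> nrm x = 1 ->
  is_trace (fun y => c%:C *: rank1 x y) c.
Proof.
move=> c0 x1; split=> [s os|eps e0].
  rewrite trace_sum_rank1 ler_piMr//.
  by apply: le_trans (bessel _ os) _; rewrite rdot_self x1 expr1n.
have [s os hs_sum] := parseval_approx x (divr_gt0 e0 (ltr_wpDl c0 ltr01)).
exists s => //; rewrite trace_sum_rank1; rewrite rdot_self x1 expr1n in hs_sum.
have h : 1 - fourier_sum s x < eps / (c + 1) by lra.
rewrite ltr_pdivlMr ?ltr_wpDl// in h.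
have := bessel x os; rewrite rdot_self x1 expr1n.
by move: (fourier_sum s x) h => k; nra.
Qed.

Lemma rank1_scale1 x : (fun y => 1%:C *: rank1 x y) = rank1 x.
Proof. by apply/funext => y; rewrite scale1r. Qed.

Lemma rank1_state x : nrm x = 1 -> states H (rank1 x).
Proof.
move=> x1; rewrite -rank1_scale1; apply: statesI; first exact: positive_rank1.
exact: is_trace_rank1.
Qed.

Lemma rank1K x y : nrm x = 1 -> rank1 x (rank1 x y) = rank1 x y.
Proof.
by move=> x1; rewrite {1}/rank1 inner_rank1 inner_self x1 expr1n mulr1.
Qed.

Lemma sqrt_rank1 (c : R) x : 0 <= c -> nrm x = 1 ->
  sqrt_op (fun y => c%:C *: rank1 x y) = (fun y => (Num.sqrt c)%:C *: rank1 x y).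
Proof.
move=> c0 x1; apply: sqrt_opE; first by apply: positive_rank1; rewrite sqrtr_ge0.
move=> y; rewrite (linZ _ _ (lin_rank1 x)) rank1K// scalerA -rmorphM /=.
by rewrite -expr2 sqr_sqrtr.
Qed.

Lemma sqrt_op_rank1 x : nrm x = 1 -> sqrt_op (rank1 x) = rank1 x.
Proof.
by move=> x1; rewrite -{1}rank1_scale1 sqrt_rank1// sqrtr1 rank1_scale1.
Qed.

(** The compression of [A] to the line of [x] is the scalar [<A x, x>], so only
    square roots of multiples of a projection occur. *)
Lemma fidelity_rank1 x A : nrm x = 1 -> positive_op A ->
  fidelity (rank1 x) A = (Num.sqrt (rdot (A x) x))%:C.
Proof.
move=> x1 pA; rewrite /fidelity sqrt_op_rank1//.
have -> : rank1 x \o A \o rank1 x = fun y => (rdot (A x) x)%:C *: rank1 x y.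
  apply/funext => y /=; rewrite {2}/rank1 (linZ _ _ pA.1.1) (linZ _ _ (lin_rank1 x)).
  by rewrite /rank1 pos_inner// !scalerA mulrC.
rewrite sqrt_rank1 ?pos_ge0//; apply: tr_eq.
  by apply: positive_rank1; rewrite sqrtr_ge0.
by apply: is_trace_rank1; rewrite ?sqrtr_ge0.
Qed.

End Traces.

(** * Finiteness of the fidelity *)

Section HilbertSchmidt.
Context {R : realType} {H : hilbertType R}.
Implicit Types (x y z e f w : H) (s t ws : seq H) (K A C : H -> H).

Definition hs_sum K s : R := \sum_(e <- s) nrm (K e) ^+ 2.

Definition adjoint_pair K K' : Prop := forall x y, inner (K x) y = inner x (K' y).

(** One finite set of basis vectors serves finitely many vectors at once. This allows
    exchanging a finite sum with an infinite one in [hs_adjoint]. *)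
Lemma parseval_approx_seq ws (eps : R) : 0 < eps ->
  exists2 t, onseq t & \sum_(w <- ws) rdot w w - eps < \sum_(w <- ws) fourier_sum t w.
Proof.
elim: ws eps => [|w ws IH] eps e0.
  by exists [::] => //; rewrite !big_nil sub0r oppr_lt0.
have e2 : 0 < eps / 2 by rewrite divr_gt0.
have [t1 o1 h1] := IH _ e2; have [t2 o2 h2] := parseval_approx w e2.
have ou := onseqU o1 o2; exists (undup (t1 ++ t2)) => //; rewrite !big_cons.
have le v t : onseq t -> {subset t <= t1 ++ t2} ->
    fourier_sum t v <= fourier_sum (undup (t1 ++ t2)) v.
  by move=> ot st; apply: onseq_sum_le => // u; exact: sqmod_ge0.
have le1 : \sum_(v <- ws) fourier_sum t1 v <= \sum_(v <- ws) fourier_sum (undup (t1 ++ t2)) v.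
  by apply: ler_sum => v _; apply: le => // u ut; rewrite mem_cat ut.
have le2 : fourier_sum t2 w <= fourier_sum (undup (t1 ++ t2)) w.
  by apply: le => // u ut; rewrite mem_cat ut orbT.
lra.
Qed.

(** The Hilbert-Schmidt norm of the adjoint: expand each [K e] in the basis, exchange
    the sums, and apply Bessel's inequality to each [K' f]. *)
Lemma hs_adjoint K K' (M : R) : adjoint_pair K K' ->
  (forall s, onseq s -> hs_sum K' s <= M) -> forall s, onseq s -> hs_sum K s <= M.
Proof.
move=> adj hM s os; apply/ler_addgt0Pr => eps e0.
have [t ot] := parseval_approx_seq [seq K e | e <- s] e0.
rewrite !big_map => ht.
have : \sum_(e <- s) fourier_sum t (K e) <= M.
  apply: le_trans (hM _ ot); rewrite /fourier_sum exchange_big /=.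
  apply: ler_sum => f _; rewrite -rdot_self; apply: le_trans (bessel _ os).
  apply: ler_sum => e _.
  by rewrite adj innerC sqmodJ.
have -> : hs_sum K s = \sum_(e <- s) rdot (K e) (K e).
  by apply: eq_bigr => e _; rewrite rdot_self.
lra.
Qed.

(** By Parseval and selfadjointness, [|K x|^2] is the sum of [|<x, K f>|^2], to which
    Cauchy-Schwarz applies. *)
Lemma hs_contraction K : selfadjoint K -> (forall s, onseq s -> hs_sum K s <= 1) ->
  forall x, nrm (K x) <= nrm x.
Proof.
move=> sK hK x; rewrite -(@ler_pXn2r _ 2) ?nnegrE ?nrm_ge0//.
apply/ler_addgt0Pr => eps e0; have [t ot] := parseval_approx (K x) e0.
rewrite rdot_self => ht.
suff : fourier_sum t (K x) <= nrm x ^+ 2 by lra.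
apply: (@le_trans _ _ (\sum_(f <- t) nrm x ^+ 2 * nrm (K f) ^+ 2)).
  by apply: ler_sum => f _; rewrite sK -!rdot_self cauchy_schwarz.
by rewrite -mulr_sumr ler_piMr ?sqr_ge0// hK.
Qed.

Lemma adjoint_contraction K K' : adjoint_pair K K' ->
  (forall x, nrm (K x) <= nrm x) -> forall x, nrm (K' x) <= nrm x.
Proof.
move=> adj hK x; have [->|n0] := eqVneq (nrm (K' x)) 0; first exact: nrm_ge0.
have n1 : 0 < nrm (K' x) by rewrite lt_def n0 nrm_ge0.
rewrite -(ler_pM2l n1) -expr2 -rdot_self {1}/rdot -adj -/(rdot _ _).
apply: le_trans (ler_norm _) _; apply: le_trans (rdot_le _ _) _.
by rewrite ler_wpM2r ?nrm_ge0.
Qed.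

Lemma state_sqrt_hs A s : states H A -> onseq s -> hs_sum (sqrt_op A) s <= 1.
Proof.
move=> sA os; have [_ pA _] := sA; have [pS hS] := sqrt_opP pA.
apply: le_trans (state_trace_sum_le1 sA os); rewrite /hs_sum /trace_sum.
by apply: ler_sum => e _; rewrite -rdot_self pos_rdot// hS rdotC.
Qed.

Lemma cvg_sum_seq0 (F : nat -> H -> R) s :
  (forall e, F ^~ e @ \oo --> (0 : R)) ->
  (fun n => \sum_(e <- s) F n e) @ \oo --> (0 : R).
Proof.
move=> h; elim: s => [|e s IH].
  have -> : (fun n => \sum_(e <- [::]) F n e) = cst 0.
    by apply/funext => n; rewrite big_nil.
  exact: cvg_cst.
have -> : (fun n => \sum_(f <- e :: s) F n f) =
    (fun n => F n e + \sum_(f <- s) F n f) by apply/funext => n; rewrite big_cons.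
have {2}<- : 0 + 0 = 0 :> R by rewrite addr0.
apply: cvgD => //; exact: h.
Qed.

End HilbertSchmidt.

Section FidelityFinite.
Context {R : realType} {H : hilbertType R}.
Implicit Types (x y z e f : H) (s : seq H).
Variables S T M : H -> H.
Hypotheses (pS : positive_op S) (pT : positive_op T) (pM : positive_op M).
Hypothesis hM : forall x, M (M x) = T (S (S (T x))).
Hypothesis hsS : forall s, onseq s -> hs_sum S s <= 1.
Hypothesis hsT : forall s, onseq s -> hs_sum T s <= 1.

Let L := sqrt_op M.
Let N x := x - M x.
Let powN k x := iter k N x.
Let geom k x := \sum_(0 <= j < k) powN j x.

Let linM : lin M := pM.1.1.
Let pL : positive_op L := (sqrt_opP pM).1.
Let hL x : L (L x) = M x := (sqrt_opP pM).2 x.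

(** [M] is the absolute value of [S T]. *)
Lemma nrm_polar x : nrm (M x) = nrm (S (T x)).
Proof.
apply/eqP; rewrite -(@eqrXn2 _ 2) ?nrm_ge0// -!rdot_self.
by rewrite pos_rdot// hM [in eqbRHS]pos_rdot// [in eqbRHS]pos_rdot.
Qed.

Lemma nrm_root x : nrm (L x) ^+ 2 = rdot (M x) x.
Proof. by rewrite -rdot_self pos_rdot// hL rdotC. Qed.

Lemma polar_contraction x : nrm (M x) <= nrm x.
Proof.
rewrite nrm_polar; apply: le_trans (hs_contraction (pos_sym pS) hsS _) _.
exact: hs_contraction (pos_sym pT) hsT _.
Qed.

Lemma polar_root_contraction x : nrm (L x) <= nrm x.
Proof.
rewrite -(@ler_pXn2r _ 2) ?nnegrE ?nrm_ge0// nrm_root.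
apply: le_trans (ler_norm _) _; apply: le_trans (rdot_le _ _) _.
by rewrite expr2 ler_wpM2r ?nrm_ge0 ?polar_contraction.
Qed.

(** Expanding gives [|x|^2 - 2 |L x|^2 + |M x|^2], and [|M x| <= |L x|]. *)
Lemma nrm_N x : nrm (N x) ^+ 2 <= nrm x ^+ 2 - nrm (L x) ^+ 2.
Proof.
have : nrm (M x) ^+ 2 <= nrm (L x) ^+ 2.
  by rewrite -hL ler_pXn2r ?nnegrE ?nrm_ge0 ?polar_root_contraction.
rewrite -[nrm (N x) ^+ 2]rdot_self /N rdotBl !rdotBr (rdotC x (M x)).
by rewrite -nrm_root !rdot_self; lra.
Qed.

Lemma symN : selfadjoint N.
Proof. by move=> x y; rewrite /N innerBl innerBr (pos_sym pM). Qed.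

Lemma powSN k x : powN k.+1 x = N (powN k x).
Proof. by []. Qed.

Lemma sym_powN k : selfadjoint (powN k).
Proof.
elim: k => [|k IH] x y //; rewrite powSN symN IH.
by rewrite /powN -iterSr.
Qed.

Lemma powNL k x : powN k (L x) = L (powN k x).
Proof.
elim: k => [|k IH] //; rewrite !powSN IH /N (linB _ _ pL.1.1).
by rewrite -!hL.
Qed.

(** Only even powers of [N] are used, as they are visibly positive; this is why the
    geometric sums below have [k + k] terms. *)
Lemma rdot_powN k x : rdot (M x) (powN (k + k) x) = nrm (L (powN k x)) ^+ 2.
Proof.
rewrite /powN iterD -/(powN k _) -/(powN k _) -hL.
rewrite -(selfadjoint_rdot _ _ (sym_powN k)) !powNL.
by rewrite pos_rdot// rdot_self.
Qed.

(** By [nrm_N], the terms are at most the consecutive differences of the decreasing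
    sequence [|N^k x|^2]. *)
Lemma decay x : (fun k => nrm (L (powN k x)) ^+ 2) @ \oo --> (0 : R).
Proof.
pose b k := nrm (powN k x) ^+ 2.
have db k : nrm (L (powN k x)) ^+ 2 <= b k - b k.+1.
  by have := nrm_N (powN k x); rewrite /b powSN; lra.
have cb : cvgn b.
  apply: nonincreasing_is_cvgn.
    apply/nonincreasing_seqP => k; have := db k; have := sqr_ge0 (nrm (L (powN k x))); lra.
  by exists 0 => _ [k _ <-]; exact: sqr_ge0.
have lim0 : (fun k => b k - b k.+1) @ \oo --> (0 : R).
  rewrite -[X in _ --> X](subrr (limn b)); apply: cvgB => //.
  by rewrite (@cvg_shiftS _ b).
apply: (squeeze_cvgr _ (cvg_cst 0) lim0); near=> k.
by rewrite sqr_ge0 db.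
Unshelve. all: by end_near.
Qed.

Lemma polar_geom k x : M (geom k x) = x - powN k x.
Proof.
rewrite /geom; elim: k => [|k IH]; first by rewrite big_nil (lin0 linM) subrr.
rewrite big_nat_recr// (linD _ _ linM) IH powSN /N.
by rewrite opprB [M _ - _]addrC addrA.
Qed.

Lemma sym_geom k : selfadjoint (geom k).
Proof.
move=> x y; rewrite /geom; elim: k => [|k IH].
  by rewrite !big_nil inner0l inner0r.
by rewrite !big_nat_recr// innerDl innerDr IH sym_powN.
Qed.

Let V k x := S (T (geom (k + k) x)).
Let V' k x := geom (k + k) (T (S x)).

(** [V k] stands for the partial isometry of the polar decomposition [S T = V M]:
    [M] composed with the geometric sum is [1 - N^(2k)], which tends to the
    projection on the closed range of [M]. *)
Lemma adjV k : adjoint_pair (V k) (V' k).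
Proof. by move=> x y; rewrite /V /V' (pos_sym pS) (pos_sym pT) sym_geom. Qed.

Lemma contrV k x : nrm (V k x) <= nrm x.
Proof.
rewrite /V -nrm_polar polar_geom -(@ler_pXn2r _ 2) ?nnegrE ?nrm_ge0// -!rdot_self.
rewrite rdotBl !rdotBr [rdot (powN _ _) x]rdotC.
have -> : rdot x (powN (k + k) x) = nrm (powN k x) ^+ 2.
  rewrite /powN iterD -/(powN k _) -/(powN k _).
  by rewrite -(selfadjoint_rdot _ _ (sym_powN k)) rdot_self.
have mono j y : nrm (powN j y) <= nrm y.
  elim: j => [|j IH] //; apply: le_trans IH.
  rewrite powSN -(@ler_pXn2r _ 2) ?nnegrE ?nrm_ge0//.
  by have := nrm_N (powN j y); have := sqr_ge0 (nrm (L (powN j y))); lra.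
have : nrm (powN (k + k) x) ^+ 2 <= nrm (powN k x) ^+ 2.
  rewrite {1}/powN iterD -/(powN k _) -/(powN k _).
  by rewrite ler_pXn2r ?nnegrE ?nrm_ge0.
rewrite [rdot (powN _ x) _]rdot_self.
have := sqr_ge0 (nrm (powN k x)); lra.
Qed.

(** Up to the vanishing term of [decay], [<M e, e>] equals [<T e, S (V e)>], which is
    at most half of [|T e|^2 + |S (V e)|^2]; the sums of both squares are
    at most one, the second by passing to adjoints. *)
Lemma trace_sum_le1 s : onseq s -> trace_sum M s <= 1.
Proof.
move=> os.
have bound k : trace_sum M s - \sum_(e <- s) nrm (L (powN k e)) ^+ 2 <= 1.
  have hsV : hs_sum (fun x => S (V k x)) s <= 1.
    apply: (@hs_adjoint _ _ _ (fun x => V' k (S x))) os.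
      by move=> x y; rewrite (pos_sym pS) adjV.
    move=> t ot; apply: le_trans (hsS ot); apply: ler_sum => f _.
    rewrite ler_pXn2r ?nnegrE ?nrm_ge0//.
    by apply: adjoint_contraction (contrV k) _; exact: adjV.
  suff : trace_sum M s - \sum_(e <- s) nrm (L (powN k e)) ^+ 2 <=
      (hs_sum T s + hs_sum (fun x => S (V k x)) s) / 2.
    by have := hsT os; lra.
  rewrite /trace_sum /hs_sum -sumrB -big_split /= mulr_suml; apply: ler_sum => e _.
  have -> : rdot (M e) e - nrm (L (powN k e)) ^+ 2 = rdot (T e) (S (V k e)).
    rewrite -rdot_powN -rdotBr -polar_geom -(pos_rdot _ _ pM) hM /V.
    by rewrite (pos_rdot _ _ pT) !(pos_rdot _ _ pS).
  (* the inequality between arithmetic and geometric means *)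
  have := rdot_ge0 (T e - S (V k e)).
  by rewrite rdotBl !rdotBr [rdot (S _) (T e)]rdotC !rdot_self; lra.
have h : (fun k => trace_sum M s - \sum_(e <- s) nrm (L (powN k e)) ^+ 2)
    @ \oo --> trace_sum M s.
  rewrite -[X in _ --> X]subr0; apply: cvgB; first exact: cvg_cst.
  by apply: cvg_sum_seq0 => e; exact: decay.
by apply: (ler_cvg_to h (cvg_cst (1 : R))); near=> k; exact: bound.
Unshelve. all: by end_near.
Qed.

End FidelityFinite.

(** * Pure states in terms of fidelity *)

Section Purity.
Context {R : realType} {H : hilbertType R}.
Implicit Types (x y z e : H) (A B C : H -> H).

Lemma sandwich_positive T A : positive_op T -> positive_op A ->
  positive_op (T \o A \o T).
Proof.
move=> pT pA; apply: positive_opI.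
- exact: bounded_comp (bounded_comp pT.1 pA.1) pT.1.
- by move=> x y /=; rewrite (pos_sym pT) (pos_sym pA) (pos_sym pT).
- by move=> x /=; rewrite pos_rdot// pos_ge0.
Qed.

(** The diagonal of [A] in the basis vanishes, so [A] kills each basis vector, and
    selfadjointness makes its range orthogonal to the basis. *)
Lemma trace_eq0 A : positive_op A -> is_trace A 0 -> forall x, A x = 0.
Proof.
move=> pA [ub _] x; apply: onbP.2 => e be; rewrite (pos_sym pA).
have -> : A e = 0; last by rewrite inner0r.
apply: (pos_ker pA); apply/eqP; rewrite eq_le pos_ge0// andbT.
have oe : onseq [:: e] by split=> // f; rewrite inE => /eqP ->.
by have := ub _ oe; rewrite /trace_sum big_cons big_nil addr0.
Qed.

(** The operator under the trace is positive with finite trace, so a zero trace makes it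
    and its square [T A T] vanish; then [<A (T x), T x> = 0]. *)
Lemma fidelity_eq0 C A : states H C -> states H A -> fidelity C A = 0 ->
  forall x, A (sqrt_op C x) = 0.
Proof.
move=> sC sA; have [_ pC _] := sC; have [_ pA _] := sA.
have [pT hT] := sqrt_opP pC; have [pS hS] := sqrt_opP pA.
rewrite /fidelity; set T := sqrt_op C in pT hT *; set S := sqrt_op A in pS hS *.
have [pM hM] := sqrt_opP (sandwich_positive pT pA).
set M := sqrt_op _ in pM hM *.
have hM' x : M (M x) = T (S (S (T x))) by rewrite hM /= hS.
have bM := trace_sum_le1 pS pT pM hM' (fun s => state_sqrt_hs sA)
  (fun s => state_sqrt_hs sC).
have [l hl] := is_trace_exists bM.
rewrite (tr_eq pM hl) => /complexI l0 x; rewrite {}l0 in hl.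
apply: (pos_ker pA); rewrite -(pos_rdot _ _ pT).
by rewrite -[T (A (T x))]/((T \o A \o T) x) -hM (trace_eq0 pM hl) rdot0l.
Qed.

Lemma fidelity_rank1_eq0 C x : positive_op C -> sqrt_op C x = 0 ->
  fidelity C (rank1 x) = 0.
Proof.
move=> pC Tx; rewrite /fidelity; have [pT _] := sqrt_opP pC.
have p0 : positive_op (fun=> 0 : H).
  have := positive_rank1 (0 : H) (lexx 0).
  by under eq_fun do rewrite scale0r.
have -> : sqrt_op C \o rank1 x \o sqrt_op C = fun=> 0.
  by apply/funext => y /=; rewrite /rank1 (linZ _ _ pT.1.1) Tx scaler0.
rewrite (sqrt_opE p0)//; apply: tr_eq => //; split=> [s os|eps e0].
  by rewrite /trace_sum big1// => e _; rewrite rdot0l.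
exists [::]; first by split.
by rewrite /trace_sum big_nil sub0r oppr_lt0.
Qed.

(** In the intended reading [fidelity C A = 0] says that [C] and [A] are orthogonal, and
    the hypothesis on [B] says that the support of [B] lies in that of [A]. *)
Definition pure A : Prop := forall B, states H B ->
  (forall C, states H C -> fidelity C A = 0 -> fidelity C B = 0) -> B = A.

(** Testing with the pure states of vectors orthogonal to [x] shows that [B] kills the
    orthogonal complement of [x]; the trace fixes the remaining scalar. *)
Lemma rank1_pure x : nrm x = 1 -> pure (rank1 x).
Proof.
move=> x1 B sB h; have [_ pB tB] := sB; have lB := pB.1.1.
have xx : inner x x = 1 by rewrite inner_self x1 expr1n.
have B0 y : inner y x = 0 -> B y = 0.
  move=> yx; have [->|y0] := eqVneq y 0; first exact: lin0.
  have [_ yu] := normalize y0; have u1 := nrm_normalized y0.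
  set u := _ *: y in yu u1.
  have ux : inner u x = 0 by rewrite innerZl yx mulr0.
  have := h _ (rank1_state u1).
  have p1 : positive_op (rank1 x) by have [] := rank1_state x1.
  rewrite !fidelity_rank1// /rdot inner_rank1 ux mul0r sqrtr0 => /(_ erefl).
  move=> /complexI /eqP; rewrite sqrtr_eq0 => le0.
  rewrite yu (linZ _ _ lB) (pos_ker pB) ?scaler0//.
  by apply/eqP; rewrite eq_le le0 pos_ge0.
pose c := rdot (B x) x.
have c0 : 0 <= c by exact: pos_ge0.
have Bx : B x = c%:C *: x.
  apply/eqP; rewrite -subr_eq0; apply/eqP; set y := B x - _.
  have yx : inner y x = 0 by rewrite innerBl innerZl xx mulr1 pos_inner// subrr.
  apply: rdot_eq0; rewrite /rdot {1}/y innerBl (pos_sym pB) B0// inner0r sub0r.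
  by rewrite innerZl (innerC x) yx rmorph0 mulr0 oppr0.
have BE : B = fun y => c%:C *: rank1 x y.
  apply/funext => y; apply/eqP; rewrite -subr_eq0; apply/eqP.
  have := B0 (y - inner y x *: x); rewrite innerBl innerZl xx mulr1 subrr => /(_ erefl).
  by rewrite (linB _ _ lB) (linZ _ _ lB) Bx /rank1 !scalerA mulrC.
have := tr_eq pB; rewrite tB => /(_ c); rewrite [in is_trace B]BE.
move=> /(_ (is_trace_rank1 c0 x1)).
by move=> /complexI c1; rewrite BE -c1 rank1_scale1.
Qed.

(** Any unit vector of the range of [A] gives a pure state supported in that of
    [A]. *)
Lemma pure_rank1 A : states H A -> pure A -> exists2 x, nrm x = 1 & A = rank1 x.
Proof.
move=> sA puA; have [_ pA tA] := sA; have lA := pA.1.1.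
have [z Az] : exists z, A z != 0.
  apply: contrapT => h; have A0 x : A x = 0.
    by apply: contrapT => /eqP Ax; apply: h; exists x.
  have t0 : is_trace A 0.
    split=> [s os|eps e0]; first by rewrite /trace_sum big1// => e _; rewrite A0 rdot0l.
    by exists [::]; [split|rewrite /trace_sum big_nil sub0r oppr_lt0].
  have := tr_eq pA t0; rewrite tA => /complexI /eqP; by rewrite oner_eq0.
have [_ zu] := normalize Az; have u1 := nrm_normalized Az.
set u := _ *: A z in zu u1.
exists u => //; symmetry; apply: puA; first exact: rank1_state.
move=> C sC /(fidelity_eq0 sC sA) AT; have [_ pC _] := sC.
have [pT _] := sqrt_opP pC; apply: fidelity_rank1_eq0 => //.
rewrite /u (linZ _ _ pT.1.1) [sqrt_op C (A z)]rdot_eq0 ?scaler0//.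
by rewrite pos_rdot// pos_rdot// AT rdot0r.
Qed.

End Purity.

(** * Wigner's theorem *)

Section Wigner.
Context {R : realType} {H : hilbertType R}.
Implicit Types (x y z w : H) (c : R[i]).

Lemma sqmod1 : sqmod (1 : R[i]) = 1.
Proof. by rewrite /sqmod /= expr1n expr0n addr0. Qed.

Lemma sqmod_real (a : R) : sqmod a%:C = a ^+ 2.
Proof. by rewrite /sqmod /= expr0n addr0. Qed.

Lemma sqmod_inner_self x : sqmod (inner x x) = rdot x x ^+ 2.
Proof. by rewrite inner_self sqmod_real rdot_self. Qed.

(** The squared norm of the difference expands into the given inner products. *)
Lemma isometric_comb (a : R) x y x' y' s' :
  rdot s' s' = rdot (a%:C *: x + y) (a%:C *: x + y) ->
  rdot s' x' = rdot (a%:C *: x + y) x -> rdot s' y' = rdot (a%:C *: x + y) y ->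
  rdot x' x' = rdot x x -> rdot x' y' = rdot x y -> rdot y' y' = rdot y y ->
  s' = a%:C *: x' + y'.
Proof.
move=> ss sx sy xx xy yy; apply/eqP; rewrite -subr_eq0; apply/eqP/rdot_eq0.
rewrite !(rdotBl, rdotBr, rdotDl, rdotDr, rdotZl, rdotZr).
rewrite [rdot x' s']rdotC [rdot y' s']rdotC [rdot y' x']rdotC ss sx sy xx xy yy.
rewrite !(rdotDl, rdotDr, rdotZl, rdotZr) [rdot y x]rdotC.
ring.
Qed.

Section Bargmann.
Variable g : H -> H.
Hypothesis hg : forall x y, sqmod (inner (g x) (g y)) = sqmod (inner x y).
Variable e : H.
Hypothesis e1 : inner e e = 1.

Lemma g_norm x : rdot (g x) (g x) = rdot x x.
Proof.
apply/eqP; rewrite -(@eqrXn2 _ 2) ?rdot_ge0//.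
by rewrite -!sqmod_inner_self hg.
Qed.

Lemma g_parallel x y : x != 0 -> sqmod (inner x y) = rdot x x * rdot y y ->
  exists c, g y = c *: g x.
Proof.
move=> x0 h; apply: cauchy_schwarz_eq; first by rewrite hg !g_norm.
by apply: contra_neq x0 => gx; apply: rdot_eq0; rewrite -g_norm gx rdot0l.
Qed.

Let W z := (inner (g (e + z)) (g e))^-1 *: g (e + z).
Let V z := W z - g e.

Lemma ge1 : inner (g e) (g e) = 1.
Proof. by rewrite inner_self -rdot_self g_norm rdot_self -inner_self. Qed.

Section Orth.
Variable z : H.
Hypothesis ze : inner z e = 0.

(** [V] is defined by choosing, in the line of [g (e + z)], the vector [W z] whose
    component along [g e] is exactly [1]: this normalizes all phases against [e]. *)
Lemma phase1 : sqmod (inner (g (e + z)) (g e)) = 1.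
Proof. by rewrite hg innerDl e1 ze addr0 sqmod1. Qed.

Lemma phase_neq0 : inner (g (e + z)) (g e) != 0.
Proof.
apply/eqP => h; have := phase1; rewrite h sqmod_real expr0n => /eqP.
by rewrite eq_sym oner_eq0.
Qed.

Lemma phaseV1 : sqmod (inner (g (e + z)) (g e))^-1 = 1.
Proof.
by have := sqmodM (inner (g (e + z)) (g e))^-1 (inner (g (e + z)) (g e));
  rewrite mulVf ?phase_neq0// phase1 mulr1 sqmod1.
Qed.

Lemma inner_We : inner (W z) (g e) = 1.
Proof. by rewrite /W innerZl mulVf// phase_neq0. Qed.

Lemma inner_Ve : inner (V z) (g e) = 0.
Proof. by rewrite /V innerBl inner_We ge1 subrr. Qed.

Lemma WE : W z = g e + V z.
Proof. by rewrite /V addrC subrK. Qed.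

Lemma sqmod_Wg y : sqmod (inner (W z) (g y)) = sqmod (inner (e + z) y).
Proof. by rewrite /W innerZl sqmodM phaseV1 mul1r hg. Qed.

End Orth.

Lemma inner_eV z : inner z e = 0 -> inner (g e) (V z) = 0.
Proof. by move=> ze; rewrite innerC inner_Ve// rmorph0. Qed.

Lemma sqmod_W z w : inner z e = 0 -> inner w e = 0 ->
  sqmod (inner (W z) (W w)) = sqmod (inner (e + z) (e + w)).
Proof.
by move=> ze we; rewrite {2}/W innerZr sqmodM sqmodJ phaseV1// mul1r sqmod_Wg.
Qed.

(** Comparing [e + z] and [e + w] instead of [z] and [w] gives access to the real part
    of the inner product, as [|1 + a|^2 = 1 + 2 Re a + |a|^2]. *)
Lemma sqmod_1V z w : inner z e = 0 -> inner w e = 0 ->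
  sqmod (1 + inner (V z) (V w)) = sqmod (1 + inner z w).
Proof.
move=> ze we; have := sqmod_W ze we; rewrite !WE//.
have := inner_eV we; have := inner_Ve ze.
move: (V z) (V w) => v v' ve ev; rewrite !innerDl !innerDr ge1 e1 ve ev.
by rewrite ze (innerC e w) we rmorph0 !addr0 !add0r.
Qed.

Lemma V_norm z : inner z e = 0 -> rdot (V z) (V z) = rdot z z.
Proof.
move=> ze; have := sqmod_1V ze ze; rewrite !inner_self -!(rmorphD (real_complex R) 1).
rewrite !sqmod_real -!rdot_self => /eqP.
by rewrite eqrXn2 ?addr_ge0 ?rdot_ge0// => /eqP /addrI.
Qed.

Lemma V_parallel z : inner z e = 0 -> exists2 c, V z = c *: g z & z != 0 -> sqmod c = 1.
Proof.
move=> ze; have [->|z0] := eqVneq z 0.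
  exists 0 => //; rewrite scale0r; apply: rdot_eq0.
  by rewrite V_norm ?inner0l// rdot0l.
have gez : inner (g e) (g z) = 0.
  by apply: sqmod_eq0; rewrite hg innerC ze rmorph0 sqmod_real expr0n.
have h : sqmod (inner (g z) (V z)) = rdot (g z) (g z) * rdot (V z) (V z).
  rewrite g_norm V_norm//.
  rewrite /V innerBr [inner (g z) (g e)]innerC gez rmorph0 subr0.
  rewrite innerC sqmodJ sqmod_Wg// innerDl (innerC e) ze rmorph0 add0r.
  by rewrite sqmod_inner_self expr2.
have gz0 : g z != 0 by apply: contra_neq z0 => gx; apply: rdot_eq0; rewrite -g_norm gx rdot0l.
have [c Vc] := cauchy_schwarz_eq h gz0; exists c => // _.
have := V_norm ze; rewrite Vc rdot_self sqr_nrmZ -rdot_self g_norm => hc.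
apply: (@mulIf _ (rdot z z)); last by rewrite hc mul1r.
by apply: contra_neq z0; exact: rdot_eq0.
Qed.

(** Combine [|1 + a| = |1 + a'|] from [sqmod_1V] with [|a| = |a'|]. *)
Lemma V_rdot z w : inner z e = 0 -> inner w e = 0 -> rdot (V z) (V w) = rdot z w.
Proof.
move=> ze we.
have h2 : sqmod (inner (V z) (V w)) = sqmod (inner z w).
  have [z0|z0] := eqVneq z 0.
    have -> : V z = 0 by apply: rdot_eq0; rewrite V_norm// z0 rdot0l.
    by rewrite z0 !inner0l.
  have [w0|w0] := eqVneq w 0.
    have -> : V w = 0 by apply: rdot_eq0; rewrite V_norm// w0 rdot0l.
    by rewrite w0 !inner0r.
  have [c -> hc] := V_parallel ze; have [d -> hd] := V_parallel we.
  by rewrite innerZl innerZr !sqmodM sqmodJ hc// hd// !mul1r hg.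
have := sqmod_1V ze we; move: h2; rewrite /rdot.
case: (inner (V z) (V w)) => a b; case: (inner z w) => a' b'.
rewrite /sqmod /= !add0r => h2 h1.
have : (1 + a) ^+ 2 - a ^+ 2 = (1 + a') ^+ 2 - a' ^+ 2 by lra.
by rewrite !sqrrD expr1n !mul1r; lra.
Qed.

Lemma orthD z w : inner z e = 0 -> inner w e = 0 -> inner (z + w) e = 0.
Proof. by move=> ze we; rewrite innerDl ze we addr0. Qed.

Lemma orthZ c z : inner z e = 0 -> inner (c *: z) e = 0.
Proof. by move=> ze; rewrite innerZl ze mulr0. Qed.

Lemma V_comb (a : R) z w : inner z e = 0 -> inner w e = 0 ->
  V (a%:C *: z + w) = a%:C *: V z + V w.
Proof.
move=> ze we; have h := orthD (orthZ a%:C ze) we.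
by apply: (@isometric_comb a z w); rewrite V_rdot.
Qed.

Lemma V_add z w : inner z e = 0 -> inner w e = 0 -> V (z + w) = V z + V w.
Proof. by move=> ze we; rewrite -{1}[z]scale1r V_comb// scale1r. Qed.

Lemma V_0 : V 0 = 0.
Proof. by apply: rdot_eq0; rewrite V_norm ?inner0l// rdot0l. Qed.

Lemma V_scale_real (a : R) z : inner z e = 0 -> V (a%:C *: z) = a%:C *: V z.
Proof.
by move=> ze; rewrite -[a%:C *: z]addr0 V_comb ?inner0l// V_0 addr0.
Qed.

Lemma rdot_iz z : rdot ('i *: z) z = 0.
Proof. by rewrite /rdot innerZl inner_self /=; ring. Qed.

(** [V ('i z)] lies on the line of [V z] by the equality case of Cauchy-Schwarz, is
    orthogonal to [V z] for the real form, and has the same norm. *)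
Lemma V_i z : inner z e = 0 -> V ('i *: z) = 'i *: V z \/ V ('i *: z) = - ('i *: V z).
Proof.
move=> ze; have ize := orthZ 'i ze.
have [z0|z0] := eqVneq z 0.
  by left; rewrite z0 scaler0 V_0 scaler0.
have Vz0 : V z != 0.
  by apply: contra_neq z0 => h; apply: rdot_eq0; rewrite -V_norm// h rdot0l.
have iz : rdot ('i *: z) ('i *: z) = rdot z z.
  by rewrite !rdot_self sqr_nrmZ /sqmod /= expr0n expr1n add0r mul1r.
have h : sqmod (inner (V z) (V ('i *: z))) =
    rdot (V z) (V z) * rdot (V ('i *: z)) (V ('i *: z)).
  have iz0 : 'i *: z != 0.
    by apply: contra_neq z0 => h; apply: rdot_eq0; rewrite -iz h rdot0l.
  rewrite !V_norm// iz.
  have [c -> hc] := V_parallel ze; have [d -> hd] := V_parallel ize.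
  rewrite innerZl innerZr !sqmodM sqmodJ hc// hd// !mul1r hg.
  rewrite innerZr sqmodM sqmodJ sqmod_inner_self.
  by rewrite /sqmod /= expr0n expr1n add0r mul1r expr2.
have [[a b] Vc] := cauchy_schwarz_eq h Vz0.
have vv : rdot (V z) (V z) != 0 by apply: contra_neq Vz0; exact: rdot_eq0.
have a0 : a = 0.
  have := rdot_iz z; rewrite -V_rdot// Vc /rdot innerZl inner_self /= mulr0 subr0.
  by rewrite -rdot_self => /eqP; rewrite mulf_eq0 (negbTE vv) orbF => /eqP.
have : b ^+ 2 = 1.
  have := V_norm ize; rewrite iz Vc rdot_self sqr_nrmZ -rdot_self V_norm//.
  rewrite /sqmod /= a0 expr0n add0r => hb.
  apply: (@mulIf _ (rdot z z)); last by rewrite hb mul1r.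
  by rewrite -V_norm.
move=> /eqP; rewrite sqrf_eq1 Vc a0 => /orP[/eqP->|/eqP->]; [by left|right].
by rewrite -scaleNr; congr (_ *: _); apply/eqP; rewrite eq_complex /= oppr0 !eqxx.
Qed.

Definition semilin (s : R[i]) : Prop :=
  forall z, inner z e = 0 -> V ('i *: z) = s *: V z.

(** The sign in [V_i] does not depend on the vector: if [z] and [w] had opposite signs,
    then either sign for [z + w] would force [V z] or [V w] to vanish. *)
Lemma V_semilinear : semilin 'i \/ semilin (- 'i).
Proof.
have [h|/existsNP[z /not_implyP[ze nz]]] := pselect (semilin 'i); first by left.
have [h|/existsNP[w /not_implyP[we nw]]] := pselect (semilin (- 'i)); first by right.
exfalso.
have Vz : V ('i *: z) = - ('i *: V z) by case: (V_i ze).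
have Vw : V ('i *: w) = 'i *: V w.
  by case: (V_i we) => // h; case: nw; rewrite scaleNr.
have i0 : ('i : R[i]) != 0.
  by apply/eqP => -[/eqP]; rewrite oner_eq0.
have two v : v + v = 0 :> H -> v = 0.
  rewrite -mulr2n -scaler_nat => /eqP; rewrite scaler_eq0 pnatr_eq0 /=.
  by move/eqP.
have := V_i (orthD ze we); rewrite (scalerDr 'i z w) !V_add// ?orthZ// Vz Vw.
rewrite (scalerDr 'i (V z) (V w)) => -[/addIr h|].
  apply: nz; rewrite Vz -[RHS]opprK; congr (- _).
  have -> : 'i *: V z = 0 by apply: two; rewrite -{1}h addNr.
  by rewrite oppr0.
rewrite opprD => /addrI h; apply: nw; rewrite Vw scaleNr -h.
have -> : 'i *: V w = 0 by apply: two; rewrite {1}h addNr.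
by [].
Qed.

Lemma V_linear (sg : {rmorphism R[i] -> R[i]}) :
  (forall a : R, sg a%:C = a%:C) -> semilin (sg 'i) ->
  forall c z, inner z e = 0 -> V (c *: z) = sg c *: V z.
Proof.
move=> sgR hi c z ze; rewrite [c]complexE rmorphD rmorphM /= !sgR.
rewrite !scalerDl ![_ * (complex.Im c)%:C]mulrC -!scalerA.
rewrite V_comb//; last exact/orthZ/orthZ.
by rewrite V_scale_real ?hi//; exact: orthZ.
Qed.

Section Extension.
Variable sg : {rmorphism R[i] -> R[i]}.
Hypothesis sg_re : forall a b : R[i],
  complex.Re (sg a * (sg b)^*%C) = complex.Re (a * b^*%C).
Hypothesis V_sg : forall c z, inner z e = 0 -> V (c *: z) = sg c *: V z.

Let pi x := x - inner x e *: e.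
(** The extension of [V] from the orthogonal complement of [e] to [H], sending [e] to
    [g e]. *)
Definition wigner_ext x : H := sg (inner x e) *: g e + V (pi x).

Lemma pi_orth x : inner (pi x) e = 0.
Proof. by rewrite /pi innerBl innerZl e1 mulr1 subrr. Qed.

Lemma pi_lin c x y : pi (c *: x + y) = c *: pi x + pi y.
Proof.
rewrite /pi innerDl innerZl scalerDl scalerBr scalerA opprD.
by rewrite addrACA.
Qed.

Lemma wigner_ext_lin c x y :
  wigner_ext (c *: x + y) = sg c *: wigner_ext x + wigner_ext y.
Proof.
rewrite /wigner_ext pi_lin (V_add (orthZ c (pi_orth x)) (pi_orth y)).
rewrite (V_sg c (pi_orth x)) innerDl innerZl rmorphD rmorphM.
move: (V (pi x)) (V (pi y)) => v w.
by rewrite scalerDr scalerDl scalerA addrACA.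
Qed.

Lemma wigner_ext_rdot x y : rdot (wigner_ext x) (wigner_ext y) = rdot x y.
Proof.
have [px py] := (pi_orth x, pi_orth y).
have vv := V_rdot px py; have ex := inner_Ve px; have ey := inner_eV py.
rewrite /wigner_ext.
have -> : rdot x y = complex.Re (inner x e * (inner y e)^*%C) + rdot (pi x) (pi y).
  rewrite -{1}(subrK (inner x e *: e) x) -{1}(subrK (inner y e *: e) y).
  rewrite -/(pi x) -/(pi y);
  move: (pi x) (pi y) px py (inner x e) (inner y e) => u v pu pv a b.
  rewrite {1}/rdot !innerDl !innerDr !innerZl !innerZr pu (innerC e v) pv e1 rmorph0.
  by rewrite !mulr0 mulr1 addr0 add0r addrC raddfD.
rewrite -vv; move: (V (pi x)) (V (pi y)) ex ey => v w ve ew.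
rewrite {1}/rdot !innerDl !innerDr !innerZl !innerZr ve ew ge1//.
by rewrite !mulr0 mulr1 addr0 add0r raddfD /= sg_re.
Qed.

(** If [x] is not orthogonal to [e], it is a multiple of some [e + z], whose image
    under [g] spans the line of [W z = g e + V z]. *)
Lemma wigner_ext_parallel x : exists c, wigner_ext x = c *: g x.
Proof.
have px := pi_orth x; have [a0|a0] := eqVneq (inner x e) 0.
  have -> : wigner_ext x = V x.
    by rewrite /wigner_ext /pi a0 rmorph0 !scale0r add0r subr0.
  by have [c -> _] := V_parallel a0; exists c.
have pz := orthZ (inner x e)^-1 px; set z := _ *: _ in pz.
have xE : x = inner x e *: (e + z).
  by rewrite scalerDr scalerA mulfV// scale1r /pi addrC subrK.
have -> : wigner_ext x = sg (inner x e) *: W z.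
  rewrite WE (scalerDr _ (g e)) -(V_sg _ pz) scalerA mulfV// scale1r.
  by [].
have [x0|x0] := eqVneq x 0; first by rewrite x0 inner0l eqxx in a0.
have [c gE] : exists c, g (e + z) = c *: g x.
  apply: g_parallel => //; move: xE; move: (e + z) => y ->.
  rewrite innerZl sqmodM sqmod_inner_self !rdot_self sqr_nrmZ; ring.
by rewrite /W gE !scalerA; eexists.
Qed.

End Extension.
End Bargmann.

Lemma bijectiveI (U : H -> H) : injective U -> (forall y, exists x, U x = y) ->
  bijective U.
Proof.
move=> inj surj; exists (inv_op U) => [x|y].
  by apply: inj; exact: (getI (P := [set z | U z = U x]) (erefl (U x))).
have [x hx] := surj y; exact: (getI (P := [set z | U z = y]) hx).
Qed.

Section WignerTheorem.
Variable f : H -> H.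
Hypothesis hf : forall x y, nrm x = 1 -> nrm y = 1 ->
  sqmod (inner (f x) (f y)) = sqmod (inner x y).
Hypothesis fsurj : forall y, nrm y = 1 ->
  exists x, nrm x = 1 /\ exists c, y = c *: f x.

Let g x := (nrm x)%:C *: f (((nrm x)^-1)%:C *: x).

Lemma homogeneous_sqmod x y : sqmod (inner (g x) (g y)) = sqmod (inner x y).
Proof.
rewrite /g; have [->|x0] := eqVneq x 0; first by rewrite nrm0 scale0r !inner0l.
have [->|y0] := eqVneq y 0; first by rewrite nrm0 scale0r !inner0r.
have [_ xE] := normalize x0; have [_ yE] := normalize y0.
rewrite [in RHS]xE [in RHS]yE.
have := hf (nrm_normalized x0) (nrm_normalized y0).
by move: (_ *: x) (_ *: y) => u v fuv; rewrite !innerZl !innerZr !sqmodM fuv.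
Qed.

Lemma homogeneous_unit x : nrm x = 1 -> g x = f x.
Proof. by move=> x1; rewrite /g x1 invr1 !scale1r. Qed.

(** [sg] below is the identity or the conjugation, according to the sign in
    [V_semilinear]. *)
Lemma wigner : exists U : H -> H, (unitary_op U \/ antiunitary_op U) /\
  forall x, nrm x = 1 -> exists c, U x = c *: f x.
Proof.
have [[x0 x0n]|H0] := pselect (exists x : H, x != 0); last first.
  have H0' (x : H) : x = 0 by apply: contrapT => /eqP h; apply: H0; exists x.
  exists id; split; last by move=> x; rewrite (H0' x) nrm0 => /eqP; rewrite eq_sym oner_eq0.
  by left; split=> //; exists id.
have [e1 _] := normalize x0n; set e := _ *: x0 in e1.
have key (sg : {rmorphism R[i] -> R[i]}) (sgR : forall a : R, sg a%:C = a%:C)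
    (sg_re : forall a b : R[i],
       complex.Re (sg a * (sg b)^*%C) = complex.Re (a * b^*%C))
    (sgK : involutive sg) (hi : semilin g e (sg 'i)) :
  exists U : H -> H, [/\ forall c x y, U (c *: x + y) = sg c *: U x + U y,
    forall c x, U (c *: x) = sg c *: U x, bijective U,
    forall x y, rdot (U x) (U y) = rdot x y &
    forall x, nrm x = 1 -> exists c, U x = c *: f x].
  have hV := V_linear homogeneous_sqmod e1 sgR hi.
  have Ul := wigner_ext_lin homogeneous_sqmod e1 hV.
  have Ur := wigner_ext_rdot homogeneous_sqmod e1 sg_re.
  have Up := wigner_ext_parallel homogeneous_sqmod e1 hV.
  set U := wigner_ext g e sg in Ul Ur Up.
  have Upf x : nrm x = 1 -> exists c, U x = c *: f x.
    by move=> x1; have [c ->] := Up x; exists c; rewrite homogeneous_unit.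
  have Un x : nrm (U x) = nrm x.
    by apply/eqP; rewrite -(@eqrXn2 _ 2) ?nrm_ge0// -!rdot_self Ur.
  have U0 : U 0 = 0 by apply: nrm_eq0; rewrite Un nrm0.
  have UZ c x : U (c *: x) = sg c *: U x.
    by have := Ul c x 0; rewrite U0 !addr0.
  exists U; split=> //; apply: bijectiveI.
    move=> x y xy; apply/eqP; rewrite -subr_eq0; apply/eqP/nrm_eq0.
    rewrite -Un addrC -scaleN1r Ul rmorphN1 scaleN1r xy addNr; exact: nrm0.
  move=> y; have [->|y0] := eqVneq y 0; first by exists 0.
  have [_ yE] := normalize y0; set u := _ *: y in yE.
  have [x [x1 [d ud]]] := fsurj (nrm_normalized y0 : nrm u = 1).
  have [c Ux] := Upf x x1.
  have c0 : c != 0.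
    apply/eqP => c0; have := Un x; rewrite Ux c0 scale0r nrm0 x1.
    by move=> /eqP; rewrite eq_sym oner_eq0.
  exists (sg ((nrm y)%:C * d / c) *: x); rewrite UZ sgK Ux scalerA mulfVK//.
  by rewrite -scalerA -ud.
have [hi|hi] := V_semilinear homogeneous_sqmod e1.
- have [|||U [Ul UZ Ub Ur Uf]] := key idfun _ _ _ hi => //.
  exists U; split=> //; left; split=> // x y.
  by rewrite !innerE -[_ *: U y]UZ !Ur.
- have hi' : semilin g e ((@conjc R : {rmorphism R[i] -> R[i]}) 'i).
    move=> z ze; rewrite hi//; congr (_ *: _).
    by apply/eqP; rewrite eq_complex /= oppr0 !eqxx.
  have [|||U [Ul UZ Ub Ur Uf]] := key (@conjc R) _ _ _ hi'.
  + by move=> a; exact: conjc_real.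
  + by move=> [a b] [c d] /=; ring.
  + exact: conjcK.
  exists U; split=> //; right; split=> // x y.
  have Ui : U ('i *: y) = (-1)%:C *: ('i *: U y).
    rewrite UZ scalerA; congr (_ *: _).
    by apply/eqP; rewrite eq_complex /=; apply/andP; split; apply/eqP; ring.
  rewrite [inner x y]innerE [LHS]innerE Ur.
  have -> : rdot (U x) ('i *: U y) = - rdot x ('i *: y).
    by rewrite -(Ur x ('i *: y)) Ui rdotZr; ring.
  by [].
Qed.

End WignerTheorem.
End Wigner.

(** * Bijections preserving fidelity *)

Section FidelityPreservers.
Context {R : realType} {H : hilbertType R}.
Implicit Types (x y z : H) (A B C : states H).

Definition state_of (A : H -> H) (sA : states H A) : states H :=
  exist _ A (mem_set sA).

Lemma stateP A : states H (sval A).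
Proof. exact: set_mem (valP A). Qed.

Lemma state_pos A : positive_op (sval A).
Proof. by have [] := stateP A. Qed.

Lemma bures_dist_fidelity A B A' B' :
  bures_dist (sval A') (sval B') = bures_dist (sval A) (sval B) ->
  fidelity (sval A') (sval B') = fidelity (sval A) (sval B).
Proof.
have t1 C : tr (sval C) = 1 by have [] := stateP C.
move=> /(congr1 (fun c => c ^+ 2)); rewrite !sqrtCK !t1 => /addrI /oppr_inj /eqP.
by rewrite eqr_pMn2r// => /eqP.
Qed.

Lemma fidelity_pure x y : nrm x = 1 -> nrm y = 1 ->
  fidelity (rank1 x) (rank1 y) = (Num.sqrt (sqmod (inner x y)))%:C.
Proof.
move=> x1 y1; have [_ p1 _] := rank1_state y1.
by rewrite fidelity_rank1// /rdot inner_rank1 (innerC y) -sqmodE.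
Qed.

Lemma sqrtr_inj_ge0 (a b : R) : 0 <= a -> 0 <= b -> Num.sqrt a = Num.sqrt b -> a = b.
Proof.
by move=> a0 b0 /(congr1 (fun c => c ^+ 2)); rewrite !sqr_sqrtr.
Qed.

Lemma rank1_phase x y c : nrm x = 1 -> nrm y = 1 -> y = c *: x -> rank1 y = rank1 x.
Proof.
move=> x1 y1 yE; have c1 : sqmod c = 1.
  have := sqr_nrmZ c x.
  by rewrite -yE x1 y1 expr1n mulr1 => <-.
apply/funext => z; rewrite yE /rank1 innerZr scalerA [_^*%C * _]mulrC.
by rewrite -mulrA [_^*%C * c]mulrC -sqmodE c1 mulr1.
Qed.

(** The surjectivity of [phi] makes its test states range over all states. *)
Lemma pure_preserved (phi psi : states H -> states H) : cancel psi phi ->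
  (forall A B, fidelity (sval (phi A)) (sval (phi B)) = fidelity (sval A) (sval B)) ->
  forall A, pure (sval A) -> pure (sval (phi A)).
Proof.
move=> psiK fid A pA B sB h.
suff : psi (state_of sB) = A by move=> <-; rewrite psiK.
apply: val_inj; apply: pA; first exact: stateP.
move=> C sC CA; have := h (sval (phi (state_of sC))) (stateP _).
by rewrite fid /= CA -[B]/(sval (state_of sB)) -{1}(psiK (state_of sB)) fid; exact.
Qed.

Variable phi : states H -> states H.
Hypothesis phi_bij : bijective phi.
Hypothesis phi_fid : forall A B,
  fidelity (sval (phi A)) (sval (phi B)) = fidelity (sval A) (sval B).

Lemma phi_rank1 x : exists y, nrm x = 1 -> nrm y = 1 /\
  forall A, sval A = rank1 x -> sval (phi A) = rank1 y.
Proof.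
have [x1|x1] := pselect (nrm x = 1); last by exists x.
have [psi phiK psiK] := phi_bij.
have pu : pure (sval (state_of (rank1_state x1))) by exact: rank1_pure.
have [y y1 yE] := pure_rank1 (stateP _) (pure_preserved psiK phi_fid pu).
exists y => _; split=> // A AE; rewrite -yE; congr (sval (phi _)).
exact: val_inj.
Qed.

Lemma fidelity_preserver : exists U : H -> H,
  (unitary_op U \/ antiunitary_op U) /\
  forall A, sval (phi A) = U \o sval A \o inv_op U.
Proof.
have [psi phiK psiK] := phi_bij.
have [f hf] := choice phi_rank1.
have f1 x : nrm x = 1 -> nrm (f x) = 1 by move=> /hf[].
have fE x (x1 : nrm x = 1) : sval (phi (state_of (rank1_state x1))) = rank1 (f x).
  by have [_ ->] := hf x x1.
have f_sqmod x y : nrm x = 1 -> nrm y = 1 ->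
    sqmod (inner (f x) (f y)) = sqmod (inner x y).
  move=> x1 y1; apply: sqrtr_inj_ge0; rewrite ?sqmod_ge0//; apply: complexI.
  by rewrite -!fidelity_pure ?f1// -!fE phi_fid.
have f_surj y : nrm y = 1 -> exists x, nrm x = 1 /\ exists c, y = c *: f x.
  move=> y1; pose A := psi (state_of (rank1_state y1)).
  have pu : pure (sval A).
    have psi_fid B C :
        fidelity (sval (psi B)) (sval (psi C)) = fidelity (sval B) (sval C).
      by rewrite -phi_fid !psiK.
    exact: (@pure_preserved psi phi phiK psi_fid (state_of (rank1_state y1))
      (rank1_pure y1)).
  have [x x1 xE] := pure_rank1 (stateP _) pu; exists x; split=> //.
  exists (inner y (f x)); have [_ hA] := hf x x1.
  have := hA _ xE; rewrite /A psiK /= => e.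
  by rewrite -/(rank1 (f x) y) -e /rank1 inner_self y1 expr1n scale1r.
have [U [UU Uf]] := wigner f_sqmod f_surj; exists U; split=> // A.
have [[sg [sgR Ul]] [Ub Un]] : (exists sg : R[i] -> R[i],
    (forall a : R, sg a%:C = a%:C) /\
    forall c x y, U (sg c *: x + y) = c *: U x + U y) /\ bijective U /\
    forall x y, rdot (U x) (U y) = rdot x y.
  case: UU => -[lU bU iU].
    by split; [exists id|split=> // x y; rewrite /rdot iU].
  split; last first.
    by split=> // x y; rewrite /rdot iU; case: (inner x y).
  exists Num.conj; split=> [a|c x y]; first exact: conjc_real.
  by rewrite lU /= conjCK.
have Unrm x : nrm (U x) = nrm x.
  by apply/eqP; rewrite -(@eqrXn2 _ 2) ?nrm_ge0// -!rdot_self Un.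
have U0 : U 0 = 0 by apply: nrm_eq0; rewrite Unrm nrm0.
have UZr (a : R) x : U (a%:C *: x) = a%:C *: U x.
  by rewrite -[in LHS]sgR -[sg _ *: x]addr0 Ul U0 addr0.
have [V UK VK] := Ub.
have invE y : inv_op U y = V y.
  apply: (can_inj UK); rewrite VK.
  exact: (getI (P := [set x | U x = y]) (VK y)).
have pA := state_pos A; have pB := state_pos (phi A).
set B := sval (phi A) in pB *.
(* the fidelities of [A] with [rank1 x] and of [phi A] with its image agree *)
have AB x : rdot (B (U x)) (U x) = rdot (sval A x) x.
  have [->|x0] := eqVneq x 0; first by rewrite U0 !rdot0r.
  have [uu ->] := normalize x0; have := nrm_normalized x0.
  set u := _ *: x => u1.
  rewrite UZr (linZ _ _ pA.1.1) (linZ _ _ pB.1.1).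
  rewrite !(rdotZl (nrm x)) !(rdotZr (nrm x)).
  suff -> : rdot (B (U u)) (U u) = rdot (sval A u) u by [].
  have Uu1 : nrm (U u) = 1 by rewrite Unrm.
  have [c Uc] := Uf u u1.
  apply: sqrtr_inj_ge0; rewrite ?pos_ge0//; apply: complexI.
  rewrite -!fidelity_rank1// (rank1_phase (f1 _ u1) Uu1 Uc) -fE.
  by rewrite phi_fid.
pose E y := U (sval A (V y)).
have linE : lin E.
  move=> c y z; rewrite /E.
  have -> : V (c *: y + z) = sg c *: V y + V z.
    by apply: (can_inj UK); rewrite Ul !VK.
  by rewrite pA.1.1 Ul.
have UA x : inner (U (sval A x)) (U x) = (rdot (sval A x) x)%:C.
  rewrite -pos_inner//; case: UU => -[_ _ ->] //.
  by rewrite pos_inner//; exact: conjc_real.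
suff h x y : inner (B x) y - inner (E x) y = 0.
  apply/funext => x /=; rewrite invE -/(E x); apply: inner_orth_eq => y.
  by apply/eqP; rewrite -subr_eq0 h.
have lB := pB.1.1.
move: x y; apply: sesquilinear_eq0 => [x y z|x y z|x y|x y|x].
- by rewrite (linD _ _ lB) (linD _ _ linE) !innerDl; ring.
- by rewrite !innerDr; ring.
- by rewrite (linZ _ _ lB) (linZ _ _ linE) !inner_il; ring.
- by rewrite !inner_ir; ring.
- by rewrite -(VK x) /E UK UA pos_inner// AB subrr.
Qed.

End FidelityPreservers.

Theorem theorem2 (R : realType) (H : hilbertType R)
    (phi : states H -> states H)
    (phi_bij : bijective phi)
    (phi_isom : forall A B : states H,
        bures_dist (sval (phi A)) (sval (phi B)) = bures_dist (sval A) (sval B)) :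
  exists U : H -> H,
    (unitary_op U \/ antiunitary_op U) /\
    forall A : states H, sval (phi A) = U \o sval A \o inv_op U.
Proof.
by apply: fidelity_preserver => // A B; exact: bures_dist_fidelity.
Qed.
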